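(* Let $n\ge2$, $k\ge1$. The Loewner ellipsoid (minimum-volume ellipsoid containing) of $\overline C^*$, as a convex body in $M$, is the ball $\{f\in M:\|f-r^{2k}\|\le\sqrt{D(n,2k)-1}\}$, i.e. center $r^{2k}$ and radius $\sqrt{\binom{n+2k-1}{2k}-1}$.
   Context: $P_{n,2k}$: real forms of degree $2k$ in $n$ variables; $r^{2k}=(x_1^2+\dots+x_n^2)^k$; $\langle f,g\rangle=\int_{S^{n-1}}fg\,d\sigma$, $\sigma$ the rotation-invariant probability measure on $S^{n-1}$, $\|f\|=\langle f,f\rangle^{1/2}$. $M=\{f\in P_{n,2k}:\int f\,d\sigma=1\}$, $C$ the cone of nonnegative forms, $C^*=\{f\in P_{n,2k}:\langle f,g\rangle\ge0\ \forall g\in C\}$, $\overline C^*=C^*\cap M$. $D(n,2k)=\binom{n+2k-1}{2k}$. *)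

(* Defs.v *)
From HB Require Import structures.
From mathcomp Require Import all_boot all_order all_algebra.
From mathcomp Require Import all_classical all_reals all_analysis.
Set Implicit Arguments. Unset Strict Implicit. Unset Printing Implicit Defensive.
Import Order.TTheory GRing.Theory Num.Theory.
Local Open Scope classical_set_scope.
Local Open Scope ring_scope.

Definition mon (n d : nat) :=
  {t : n.-tuple 'I_d.+1 | \sum_(i <- t) (i : nat) == d}.

Section Forms.
Variable R : realType.

Definition pform (n d : nat) := {ffun mon n d -> R}.

Definition feval n d (f : pform n d) (x : seq R) : R :=
  \sum_(a : mon n d) f a * \prod_(i < n) (nth 0 x i) ^+ (tnth (val a) i).

Fixpoint iint (m : nat) (g : seq R -> \bar R) : \bar R :=
  match m with
  | 0 => g [::]
  | m'.+1 => (\int[@lebesgue_measure R]_x iint m' (fun s => g (x :: s)))%E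
  end.

Definition lebm (m : nat) (A : set (seq R)) : \bar R :=
  iint m (fun s => (\1_A s)%:E).

Definition sqn (x : seq R) : R := \sum_(t <- x) t ^+ 2.

Definition unit_ball : set (seq R) := [set x | sqn x <= 1].
Definition radial (x : seq R) : seq R := [seq t / Num.sqrt (sqn x) | t <- x].

(* Integral against sigma, the rotation-invariant probability measure on
   S^{n-1}, defined as the push-forward under x |-> x/|x| of the normalized
   Lebesgue measure of the unit ball B^n (the cone-measure construction:
   sigma(A) = vol_n{t a : a in A, 0 <= t <= 1} / vol_n(B^n)). *)
Definition sphere_int (n : nat) (F : seq R -> R) : R :=
  fine (iint n (fun x => (\1_unit_ball x * F (radial x))%:E)) /
  fine (lebm n unit_ball).

Variables n d : nat.

Definition sip (f g : pform n d) : R :=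
  sphere_int n (fun x => feval f x * feval g x).
Definition snorm (f : pform n d) : R := Num.sqrt (sip f f).

Definition Mset : set (pform n d) := [set f | sphere_int n (feval f) = 1].
Definition Hset : set (pform n d) := [set f | sphere_int n (feval f) = 0].

Definition Cnn : set (pform n d) :=
  [set g | forall x : seq R, size x = n -> 0 <= feval g x].
Definition Cdual : set (pform n d) :=
  [set f | forall g, Cnn g -> 0 <= sip f g].
Definition Cbar : set (pform n d) := Cdual `&` Mset.

(* A (solid, nondegenerate) ellipsoid in the affine space M: the image of
   the closed unit ball of (H, <,>) under an invertible affine map of M,
   i.e. c + L(ball), with c in M and L linear, mapping H injectively
   (hence bijectively) into H. *)
Definition ellipsoid (E : set (pform n d)) : Prop :=
  exists c : pform n d, Mset c /\
  exists L : {linear pform n d -> pform n d},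
    (forall u, Hset u -> Hset (L u)) /\
    (forall u, Hset u -> L u = 0 -> u = 0) /\
    E = [set c + L u | u in [set u | Hset u /\ snorm u <= 1]].

(* Volume on M.  Since int x_0^d dsigma <> 0 (d even), the coordinate
   projection forgetting the coefficient of x_0^d is an affine bijection
   from M onto R^(D-1), D = #monomials; we take as volume on M the
   pull-back of Lebesgue measure.  (Any two translation-invariant
   measures on M are proportional, so minimality of volume does not
   depend on this choice.) *)
Definition alpha0 : n.-tuple 'I_d.+1 :=
  [tuple (if (i : nat) == 0%N then inord d else ord0) | i < n].
Definition proj (f : pform n d) : seq R :=
  [seq f a | a <- enum (@predT (mon n d)) & val a != alpha0].
Definition volM (E : set (pform n d)) : \bar R :=
  lebm (#|{: mon n d}|).-1 [set proj f | f in E].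

Definition loewner_ellipsoid (K E : set (pform n d)) : Prop :=
  [/\ ellipsoid E, K `<=` E &
      forall E', ellipsoid E' -> K `<=` E' ->
        (volM E <= volM E')%E /\ (volM E' = volM E -> E' = E)].

End Forms.

(* Main.v *)
(* Let m = D(n,2k) - 1 be the dimension of the hyperplane H of forms of mean
   zero and psi_1, ..., psi_m an orthonormal basis of H.  For a unit vector v,
   q_v = r^(2k) + sum_i psi_i(v) psi_i represents evaluation at v, hence lies in
   the dual cone and in M.  Reflections show that sum_i psi_i(v)^2 does not
   depend on v; integrating, it equals m.

   The ball contains the dual body: if f = r^(2k) + g with |g|^2 = t, then
   f <= 1 + (t + m)/2 on the sphere by AM-GM, and pairing f with the nonnegative
   form (1 + (t + m)/2) r^(2k) - f gives 1 + t <= 1 + (t + m)/2, i.e. t <= m.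

   Conversely, let an ellipsoid c + A(ball) contain the dual body, B = A^-1 and
   c - r^(2k) have coordinates u.  Every q_v satisfies |B(psi(v) - u)|^2 <= 1;
   integrating over v gives |B|_F^2 + |B u|^2 <= 1.  By the arithmetic-geometric
   mean inequality applied to the diagonal of a Cholesky factor of the Gram
   matrix of B, det(B)^2 <= m^(-m), with equality only if u = 0 and B is
   m^(-1/2) times an orthogonal matrix, i.e. for the ball of radius sqrt(m). *)

(* Since |psi(v)|^2 = m, the forms q_v are contact points of the dual body with the ball. Averaging
   over v works because, under sigma, psi has mean zero and the identity as its matrix of second
   moments: this is John's decomposition of the identity at the contact points, and it leaves no
   cross terms. The lower bound on volumes uses no other points of the dual body. The obstacle is
   that sigma is given by iterated one-dimensional Lebesgue integrals over lists. Its invariance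
   under reflections rests on Tonelli's theorem and on a factorization of matrices into shears and
   smaller blocks. Additivity of the nested integrals is available for nonnegative integrands, so
   bounded signed ones are first shifted by a constant. The orthonormal basis presupposes that a
   nonzero form has positive norm, which is proved through a cube on which the form stays away from
   zero. *)
Require Import Defs.
From HB Require Import structures.
From mathcomp Require Import all_boot all_order all_algebra.
From mathcomp Require Import all_classical all_reals all_analysis.
From mathcomp Require Import measurable_realfun ring lra.
Set Implicit Arguments. Unset Strict Implicit. Unset Printing Implicit Defensive.
Import Order.TTheory GRing.Theory Num.Theory.
Local Open Scope classical_set_scope.
Local Open Scope ring_scope.

(** * Iterated integrals of jointly measurable functions *)

Section JointMeasurability.
Variable R : realType.
Local Notation mR := (measurableTypeR R).

(* Measurability of a function of a parameter and of [m] real variables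
   presented as a list, obtained by moving the variables one by one into the
   parameter space. *)
Fixpoint jmeas (m : nat) d' (U : measurableType d') d (T : measurableType d)
    (h : T -> seq R -> U) : Prop :=
  match m with
  | 0 => measurable_fun setT (fun t => h t [::])
  | m'.+1 => @jmeas m' d' U _ (T * mR)%type (fun p s => h p.1 (p.2 :: s))
  end.

Lemma jmeas_ext m d' (U : measurableType d') d (T : measurableType d)
    (h h' : T -> seq R -> U) :
  (forall t s, size s = m -> h t s = h' t s) -> jmeas m h -> jmeas m h'.
Proof.
elim: m d T h h' => [|m IH] d T h h' hh' /=.
  by apply: eq_measurable_fun => t _; exact: hh'.
by apply: IH => t s sm; apply: hh' => /=; rewrite sm.
Qed.

Lemma jmeas_comp m d1 (U : measurableType d1) d2 (V : measurableType d2)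
    d (T : measurableType d) (f : U -> V) (h : T -> seq R -> U) :
  measurable_fun setT f -> jmeas m h -> jmeas m (fun t s => f (h t s)).
Proof.
move=> mf; elim: m d T h => [|m IH] d T h /=; last exact: IH.
by move=> mh; apply: measurableT_comp.
Qed.

Lemma jmeas_pair m d1 (U : measurableType d1) d2 (V : measurableType d2)
    d (T : measurableType d) (f : T -> seq R -> U) (g : T -> seq R -> V) :
  jmeas m f -> jmeas m g -> jmeas m (fun t s => (f t s, g t s)).
Proof.
elim: m d T f g => [|m IH] d T f g /=; last exact: IH.
by move=> mf mg; apply: measurable_fun_pair.
Qed.

Lemma jmeas_param m d1 (U : measurableType d1) d (T : measurableType d)
    (f : T -> U) : measurable_fun setT f -> jmeas m (fun t _ => f t).
Proof.
elim: m d T f => [|m IH] d T f //= mf.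
by apply: (IH _ _ (f \o fst)); apply: measurableT_comp.
Qed.

Lemma jmeas_cst m d1 (U : measurableType d1) d (T : measurableType d) (u : U) :
  jmeas m (fun (_ : T) _ => u).
Proof. by apply: (@jmeas_param _ _ _ _ _ (cst u)); exact: measurable_cst. Qed.

Lemma jmeas_nth m i d (T : measurableType d) :
  jmeas m (fun (_ : T) s => nth 0 s i : mR).
Proof.
elim: m i d T => [|m IH] i d T /=.
  by apply: measurable_cst.
case: i => [|i] /=; first by apply: (@jmeas_param _ _ _ _ _ snd).
exact: IH.
Qed.

(** Measurability under a change of variables. The induction mirrors the recursion of [jmeas]: the
    first substituted coordinate joins the parameter [tau], and the others are shifted down. *)
Lemma jmeas_subst m m' d1 (U : measurableType d1) d2 (T' : measurableType d2)
    d (T : measurableType d) (g : T' -> seq R -> U) (tau : T -> seq R -> T')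
    (c : T -> seq R -> nat -> R) :
  jmeas m' g -> jmeas m tau ->
  (forall i, (i < m')%N -> jmeas m (fun t s => c t s i : mR)) ->
  jmeas m (fun t s => g (tau t s) [seq c t s i | i <- iota 0 m']).
Proof.
elim: m' d2 T' g tau c => [|m' IH] d2 T' g tau c /=.
  by move=> mg mtau _; apply: (jmeas_comp mg).
move=> mg mtau mc.
pose c' t s i := c t s i.+1.
have := IH _ _ _ (fun t s => (tau t s, c t s 0%N : mR)) c' mg.
move/(_ (jmeas_pair mtau (mc 0%N isT)) (fun i => mc i.+1)).
apply: jmeas_ext => t s _ /=; congr (g _ (_ :: _)).
by rewrite -[1%N]add1n iotaDl -map_comp.
Qed.

Lemma jmeas_reparam m d1 (U : measurableType d1) d2 (T' : measurableType d2)
    d (T : measurableType d) (g : T' -> seq R -> U) (tau : T -> T') :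
  jmeas m g -> measurable_fun setT tau -> jmeas m (fun t s => g (tau t) s).
Proof.
move=> mg mtau.
have := jmeas_subst (c := fun _ s i => nth 0 s i) mg (jmeas_param m mtau)
  (fun i _ => jmeas_nth _ _ _).
apply: jmeas_ext => t s sm /=.
by rewrite -[in RHS](mkseq_nth 0 s) sm.
Qed.

Lemma iint_ge0 m (g : seq R -> \bar R) :
  (forall s, (0 <= g s)%E) -> (0 <= iint m g)%E.
Proof.
elim: m g => [|m IH] g g0 //=.
by apply: integral_ge0 => x _; apply: IH => s; exact: g0.
Qed.

Lemma eq_iint m (g g' : seq R -> \bar R) :
  (forall s, size s = m -> g s = g' s) -> iint m g = iint m g'.
Proof.
elim: m g g' => [|m IH] g g' gg' /=; first exact: gg'.
by apply: eq_integral => x _; apply: IH => s sm; apply: gg' => /=; rewrite sm.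
Qed.

Lemma measurable_iint m d (T : measurableType d) (h : T -> seq R -> \bar R) :
  (forall t s, (0 <= h t s)%E) -> jmeas m h ->
  measurable_fun setT (fun t => iint m (h t)).
Proof.
elim: m d T h => [|m IH] d T h h0 //= mh.
have mF := IH _ (T * mR)%type _ (fun p s => h0 p.1 (p.2 :: s)) mh.
have F0 (p : T * mR) : (0 <= iint m (fun s => h p.1 (p.2 :: s)))%E.
  by apply: iint_ge0 => s; exact: h0.
exact: (measurable_fun_fubini_tonelli_F (m2 := @lebesgue_measure R) _ mF F0).
Qed.

(** The real line is a dummy parameter space here; [meas1_cons] lets the first list variable take
    its place. *)
Definition meas1 m (g : seq R -> \bar R) := jmeas m (fun (_ : mR) s => g s).

Lemma meas1_cons m (g : seq R -> \bar R) :
  meas1 m.+1 g <-> jmeas m (fun (x : mR) s => g (x :: s)).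
Proof.
split=> mg.
  by apply: (jmeas_reparam (tau := fun x : mR => (0 : mR, x)) mg); exact: measurable_fun_pair.
exact: (jmeas_reparam (tau := (@snd mR mR)) mg measurable_snd).
Qed.

Lemma measurable_iint_cons m (g : seq R -> \bar R) :
  (forall s, (0 <= g s)%E) -> meas1 m.+1 g ->
  measurable_fun [set: mR] (fun x => iint m (fun s => g (x :: s))).
Proof.
by move=> g0 /meas1_cons mg; apply: (@measurable_iint m _ mR) => // *; exact: g0.
Qed.

Lemma meas1_slice m (g : seq R -> \bar R) x :
  meas1 m.+1 g -> meas1 m (fun s => g (x :: s)).
Proof.
move=> /meas1_cons mg.
exact: (jmeas_reparam (tau := cst (x : mR)) mg (measurable_cst _)).
Qed.

Lemma le_iint m (g g' : seq R -> \bar R) :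
  (forall s, (0 <= g s)%E) -> meas1 m g -> meas1 m g' ->
  (forall s, size s = m -> (g s <= g' s)%E) -> (iint m g <= iint m g')%E.
Proof.
move=> g0 mg mg' gg'.
(* [g'] dominates [g] only on lists of length [m]. Replacing it by [g] on the other lists makes it
   nonnegative everywhere and leaves the integral unchanged. *)
pose h s := if size s == m then g' s else g s.
have mh : meas1 m h.
  by apply: jmeas_ext mg' => _ s sm; rewrite /h sm eqxx.
have {}gg' s : (g s <= h s)%E.
  by rewrite /h; case: eqP => // /gg'.
rewrite (@eq_iint _ g' h); last by move=> s sm; rewrite /h sm eqxx.
have h0 s : (0 <= h s)%E by apply: le_trans (gg' s).
elim: m {mg'} g h g0 mg mh gg' h0 => [|m IH] g1 g2 g10 mg1 mg2 g12 g20 //=.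
apply: ge0_le_integral => //.
- by move=> x _; apply: iint_ge0.
- exact: measurable_iint_cons.
- exact: measurable_iint_cons.
- by move=> x _; apply: IH => //; exact: meas1_slice.
Qed.

Lemma iintD m (g g' : seq R -> \bar R) :
  (forall s, (0 <= g s)%E) -> meas1 m g ->
  (forall s, (0 <= g' s)%E) -> meas1 m g' ->
  iint m (fun s => (g s + g' s)%E) = (iint m g + iint m g')%E.
Proof.
elim: m g g' => [|m IH] g g' g0 mg g0' mg' //=.
rewrite -ge0_integralD//.
- by apply: eq_integral => x _; rewrite IH//; exact: meas1_slice.
- by move=> x _; apply: iint_ge0.
- exact: measurable_iint_cons.
- by move=> x _; apply: iint_ge0.
- exact: measurable_iint_cons.
Qed.

Lemma iintZl m (k : R) (g : seq R -> \bar R) : 0 <= k ->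
  (forall s, (0 <= g s)%E) -> meas1 m g ->
  iint m (fun s => (k%:E * g s)%E) = (k%:E * iint m g)%E.
Proof.
move=> k0; elim: m g => [|m IH] g g0 mg //=.
rewrite -ge0_integralZl//.
- by apply: eq_integral => x _; rewrite IH//; exact: meas1_slice.
- exact: measurable_iint_cons.
- by move=> x _; apply: iint_ge0.
Qed.

(** Tonelli for one variable against a list, moving the outer integral inwards past one variable at
    a time. It allows integrating in the first variable before all others, as [linear_change_lower]
    requires. *)
Lemma iint_exchange m (h : R -> seq R -> \bar R) :
  (forall x s, (0 <= h x s)%E) -> jmeas m (h : mR -> _) ->
  (\int[@lebesgue_measure R]_x iint m (h x) =
   iint m (fun s => \int[@lebesgue_measure R]_x h x s))%E.
Proof.
elim: m h => [|m IH] h h0 mh //=.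
have mh' : jmeas m (fun (p : mR * mR) s => h p.1 (p.2 :: s)) by exact: mh.
rewrite (@fubini_tonelli _ _ mR mR R lebesgue_measure lebesgue_measure
  (fun p => iint m (fun s => h p.1 (p.2 :: s)))); last 2 first.
- by apply: (@measurable_iint m _ (mR * mR)%type) => // *; exact: h0.
- by move=> p; apply: iint_ge0.
apply: eq_integral => y _; apply: IH => //.
by apply: (jmeas_reparam (tau := fun x : mR => (x, y : mR)) mh'); exact: measurable_fun_pair.
Qed.

Lemma jmeas_section m d1 (U : measurableType d1) d (T : measurableType d)
    (h : T -> seq R -> U) s :
  size s = m -> jmeas m h -> measurable_fun setT (fun t => h t s).
Proof.
elim: m d T h s => [|m IH] d T h [|x s]//= [sm] mh.
have mp := IH _ (T * mR)%type _ s sm mh.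
apply: (measurableT_comp (g := fun t : T => (t, x : mR)) mp).
exact: measurable_fun_pair.
Qed.

Lemma jmeas_integral m d (T : measurableType d) (h : T -> R -> seq R -> \bar R) :
  (forall t x s, (0 <= h t x s)%E) ->
  jmeas m (fun (p : T * mR) s => h p.1 p.2 s) ->
  jmeas m (fun t s => (\int[@lebesgue_measure R]_x h t x s)%E).
Proof.
elim: m d T h => [|m IH] d T h h0 /= mh.
  exact: (measurable_fun_fubini_tonelli_F (m2 := @lebesgue_measure R) _ mh).
apply: (IH _ (T * mR)%type (fun p x s => h p.1 x (p.2 :: s))) => //.
(* The integrated variable and the first list variable trade places in the parameter. *)
apply: (jmeas_reparam (tau := fun q : (T * mR) * mR => (q.1.1, q.2, q.1.2) : (T * mR) * mR) mh).
apply: measurable_fun_pair; first apply: measurable_fun_pair => //.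
- exact: measurableT_comp.
- exact: measurableT_comp.
Qed.

End JointMeasurability.
Arguments jmeas_cst {R} m {d1 U d} T u.
Arguments jmeas_nth {R} m i {d} T.
Arguments jmeas_param {R} m {d1 U d T f}.

(** * Linear change of variables *)

Section LinearChange.
Variable R : realType.
Local Notation mR := (measurableTypeR R).

(** Lebesgue measure is determined by its values on half-open intervals, so it is enough to compare
    it there with |a| times its push-forward under x -> a x + b. *)
Lemma ge0_integral_affine (a b : R) (f : R -> \bar R) : a != 0 ->
  (forall x, (0 <= f x)%E) -> measurable_fun [set: mR] (f : mR -> _) ->
  (\int[@lebesgue_measure R]_x f (a * x + b)%R =
   (`|a|^-1)%:E * \int[@lebesgue_measure R]_x f x)%E.
Proof.
move=> a0 f0 mf.
pose phi (x : mR) : mR := a * x + b.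
have mphi : measurable_fun [set: mR] phi.
  by apply: measurable_funD => //; exact: measurable_funM.
have na0 : 0 <= `|a|^-1 by rewrite invr_ge0.
pose k := NngNum na0.
have := @ge0_integral_pushforward _ _ mR mR R phi mphi lebesgue_measure setT f
  measurableT mf (fun x _ => f0 x).
rewrite preimage_setT => <-.
have -> : (`|a|^-1)%:E = (k%:num)%:E by [].
rewrite -ge0_integral_mscale//.
apply: eq_measure_integral => A mA _.
(* [nu] stands for the push-forward packaged as a measure, so that it can be scaled and compared by
   uniqueness. *)
suff E (nu : {measure set mR -> \bar R}) :
    (forall B, nu B = pushforward lebesgue_measure phi B) ->
    lebesgue_measure A = mscale (NngNum (normr_ge0 a)) nu A.
  transitivity (`|a|^-1%:E * lebesgue_measure A)%E; last by [].
  rewrite (E _ (fun _ => erefl)) // /mscale/= muleA -EFinM.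
  by rewrite mulVf ?mul1e ?normr_eq0.
move=> nuE; apply: lebesgue_measure_unique => //.
move=> _ [[x y] _ <-].
transitivity (`|a|%:E * pushforward lebesgue_measure phi `]x, y])%E; last first.
  by rewrite -nuE.
rewrite /pushforward /= lebesgue_measure_itv/= lte_fin.
have [a_gt0|a_lt0|a_eq0] := ltgtP a 0; last by rewrite a_eq0 eqxx in a0.
  have -> : phi @^-1` `]x, y] = `[(y - b) / a, (x - b) / a[%classic.
    apply/seteqP; split=> z /=; rewrite !in_itv/= /phi.
      by rewrite ler_ndivrMr// ltr_ndivlMr// => /andP[? ?]; apply/andP; split; lra.
    by rewrite ler_ndivrMr// ltr_ndivlMr// => /andP[? ?]; apply/andP; split; lra.
  rewrite lebesgue_measure_itv/= lte_fin ltr_ndivrMr// mulfVK// ltrD2r.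
  case: ifPn => _; last by rewrite mule0.
  by rewrite -!EFinD -EFinM ltr0_norm//; congr EFin; field.
have -> : phi @^-1` `]x, y] = `](x - b) / a, (y - b) / a]%classic.
  apply/seteqP; split=> z /=; rewrite !in_itv/= /phi.
    by rewrite ler_pdivlMr// ltr_pdivrMr// => /andP[? ?]; apply/andP; split; lra.
  by rewrite ler_pdivlMr// ltr_pdivrMr// => /andP[? ?]; apply/andP; split; lra.
rewrite lebesgue_measure_itv/= lte_fin ltr_pdivrMr// mulfVK// ltrD2r.
case: ifPn => _; last by rewrite mule0.
by rewrite -!EFinD -EFinM gtr0_norm//; congr EFin; field.
Qed.

(** Integrands take lists and matrices act on row vectors; [vec] and [lst] pass between the two and
    are inverse to each other on lists of length [m]. *)
Definition vec m (s : seq R) : 'rV[R]_m := \row_i nth 0 s i.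
Definition lst m (v : 'rV[R]_m) : seq R := [seq v 0 i | i <- enum 'I_m].

Lemma size_lst m (v : 'rV[R]_m) : size (lst v) = m.
Proof. by rewrite size_map size_enum_ord. Qed.

Lemma nth_lst m (v : 'rV[R]_m) (i : 'I_m) : nth 0 (lst v) i = v 0 i.
Proof. by rewrite (nth_map i) ?size_enum_ord// nth_ord_enum. Qed.

Lemma lstK m (v : 'rV[R]_m) : vec m (lst v) = v.
Proof. by apply/rowP => i; rewrite mxE nth_lst. Qed.

Lemma vecK m (s : seq R) : size s = m -> lst (vec m s) = s.
Proof.
move=> sm; apply: (@eq_from_nth _ 0); rewrite size_lst// => i im.
by rewrite (nth_lst _ (Ordinal im)) mxE.
Qed.

Lemma lst_cons m (v : 'rV[R]_(1 + m)) : lst v = v 0 0 :: lst (rsubmx v).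
Proof.
rewrite /lst enum_ordSl/= -map_comp; congr (_ :: _).
by apply: eq_map => i /=; rewrite mxE; congr (v _ _); rewrite rshift1.
Qed.

Lemma vec_cons m x (s : seq R) : vec (1 + m) (x :: s) = row_mx x%:M (vec m s) :> 'rV_(1 + m).
Proof.
apply/rowP => i; rewrite mxE; case: (split_ordP i) => j ->.
  by rewrite row_mxEl ord1 mxE.
by rewrite row_mxEr mxE /= .
Qed.

Lemma meas1_lst m (g : seq R -> \bar R) d (T : measurableType d) (f : T -> seq R -> 'rV[R]_m) m' :
  meas1 m g -> (forall i, jmeas m' (fun t s => f t s 0 i : mR)) ->
  jmeas m' (fun t s => g (lst (f t s))).
Proof.
move=> mg mf.
have mc i : (i < m)%N -> jmeas m' (fun t s => nth 0 (lst (f t s)) i : mR).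
  move=> im; apply: jmeas_ext (mf (Ordinal im)) => t s _.
  by rewrite -(nth_lst _ (Ordinal im)).
have := jmeas_subst mg (jmeas_cst m' T (0 : mR)) mc.
by apply: jmeas_ext => t s _; congr g; rewrite -[RHS](mkseq_nth 0) size_lst.
Qed.

Lemma jmeasD m d (T : measurableType d) (f g : T -> seq R -> mR) :
  jmeas m f -> jmeas m g -> jmeas m (fun t s => f t s + g t s : mR).
Proof.
move=> mf mg; have := jmeas_pair mf mg.
apply: (jmeas_comp (f := fun p : mR * mR => p.1 + p.2 : mR)).
exact: measurable_funD.
Qed.

Lemma jmeasM m d (T : measurableType d) (f g : T -> seq R -> mR) :
  jmeas m f -> jmeas m g -> jmeas m (fun t s => f t s * g t s : mR).
Proof.
move=> mf mg; have := jmeas_pair mf mg.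
apply: (jmeas_comp (f := fun p : mR * mR => p.1 * p.2 : mR)).
exact: measurable_funM.
Qed.

Lemma jmeas_sum m d (T : measurableType d) I (r : seq I) (P : pred I)
   (f : I -> T -> seq R -> mR) :
  (forall i, jmeas m (f i)) -> jmeas m (fun t s => \sum_(i <- r | P i) f i t s : mR).
Proof.
move=> mf; elim: r => [|i r IH].
  by apply: jmeas_ext (jmeas_cst _ _ (0 : mR)) => t s _; rewrite big_nil.
case: (boolP (P i)) => Pi.
  by apply: jmeas_ext (jmeasD (mf i) IH) => t s _; rewrite big_cons Pi.
by apply: jmeas_ext IH => t s _; rewrite big_cons (negbTE Pi).
Qed.

Lemma jmeas_prod m d (T : measurableType d) I (r : seq I)
   (f : I -> T -> seq R -> mR) :
  (forall i, jmeas m (f i)) -> jmeas m (fun t s => \prod_(i <- r) f i t s : mR).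
Proof.
move=> mf; elim: r => [|i r IH].
  by apply: jmeas_ext (jmeas_cst _ _ (1 : mR)) => t s _; rewrite big_nil.
by apply: jmeas_ext (jmeasM (mf i) IH) => t s _; rewrite big_cons.
Qed.

Lemma jmeas_vec m m' d (T : measurableType d) i :
  jmeas m (fun (_ : T) s => vec m' s 0 i : mR).
Proof. by apply: jmeas_ext (jmeas_nth _ i _) => t s _; rewrite mxE. Qed.

Lemma jmeas_mulmx m m' m'' d (T : measurableType d) (f : T -> seq R -> 'rV[R]_m)
    (A : 'M[R]_(m, m'')) i :
  (forall i, jmeas m' (fun t s => f t s 0 i : mR)) ->
  jmeas m' (fun t s => (f t s *m A) 0 i : mR).
Proof.
move=> mf; apply: jmeas_ext (jmeas_sum (index_enum _) xpredT (fun j =>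
  jmeasM (mf j) (jmeas_cst _ _ (A j i : mR)))) => t s _.
by rewrite mxE.
Qed.

Lemma iint_translate m (v : 'rV[R]_m) (g : seq R -> \bar R) :
  (forall s, (0 <= g s)%E) -> meas1 m g ->
  iint m (fun s => g (lst (vec m s + v))) = iint m g.
Proof.
elim: m v g => [|m IH] v g g0 mg.
  by rewrite /= /lst; congr g; apply: size0nil; rewrite size_map size_enum_ord.
rewrite /=; pose F (x : R) := iint m (fun s => g (x :: s)).
transitivity (\int[@lebesgue_measure R]_x F (1 * x + v 0 0)%R)%E.
  apply: eq_integral => x _; rewrite /F mul1r.
  rewrite -(IH (rsubmx (v : 'rV_(1 + m))) (fun s => g (x + v 0 0 :: s)))//; last first.
    exact: meas1_slice.
    apply: eq_iint => s sm; congr g.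
    apply: etrans (lst_cons (vec m.+1 (x :: s) + v : 'rV_(1 + m))) _.
    rewrite !mxE/=; congr (_ :: lst _).
    by apply/rowP => j; rewrite !mxE.
rewrite ge0_integral_affine ?oner_neq0//.
- by rewrite normr1 invr1 mul1e.
- by move=> x; apply: iint_ge0.
- exact: measurable_iint_cons.
Qed.

(** The change of variables formula as a property of the matrix: it is stable under products, so it
    can be checked on factors. *)
Definition linear_change m (A : 'M[R]_m) := forall g : seq R -> \bar R,
  (forall s, (0 <= g s)%E) -> meas1 m g ->
  iint m (fun s => g (lst (vec m s *m A))) = ((`|\det A|^-1)%:E * iint m g)%E.

Lemma linear_changeM m (A B : 'M[R]_m) :
  linear_change A -> linear_change B -> linear_change (A *m B).
Proof.
move=> hA hB g g0 mg.
transitivity (iint m (fun s => g (lst (vec m (lst (vec m s *m A)) *m B)))).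
  by apply: eq_iint => s _; rewrite lstK mulmxA.
rewrite (hA (fun s => g (lst (vec m s *m B))))//.
  by rewrite hB// muleA -EFinM det_mulmx normrM invfM mulrC.
apply: meas1_lst => // i; apply: jmeas_mulmx => j; exact: jmeas_vec.
Qed.

Lemma linear_change_block m (S : 'M[R]_m) : linear_change S ->
  linear_change (block_mx 1%:M 0 0 S : 'M[R]_(1 + m)).
Proof.
move=> hS g g0 mg; rewrite det_ublock det1 mul1r /= add0n.
rewrite -ge0_integralZl//; last 2 first.
- exact: measurable_iint_cons.
- by move=> x _; apply: iint_ge0.
apply: eq_integral => x _; rewrite -hS//; last exact: meas1_slice.
apply: eq_iint => s sm; congr g.
rewrite lst_cons vec_cons mul_row_block !mulmx0 addr0 add0r row_mxKr.
by rewrite mulmx1 mxE; case: splitP => // j _; rewrite !mxE !ord1.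
Qed.

(** On row vectors this is (x, s) -> (x, s + x b): for fixed x, a translation of the inner
    variables. *)
Lemma linear_change_upper m (b : 'rV[R]_m) :
  linear_change (block_mx 1%:M b 0 1%:M : 'M[R]_(1 + m)).
Proof.
move=> g g0 mg; rewrite det_ublock !det1 mul1r normr1 invr1 mul1e /= add0n.
apply: eq_integral => x _.
rewrite -(iint_translate (x *: b) (g := fun s => g (x :: s)))//; last exact: meas1_slice.
apply: eq_iint => s sm; congr g.
rewrite lst_cons vec_cons mul_row_block !mulmx0 !mulmx1 addr0 row_mxKr.
rewrite mul_scalar_mx addrC; congr (_ :: _).
by rewrite mxE; case: splitP => // j _; rewrite !mxE !ord1.
Qed.

(** On row vectors this is (x, s) -> (a x + s c, s), affine in x for fixed s. As x is the outermost
    variable, the integrals are exchanged before and after the one-dimensional formula is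
    applied. *)
Lemma linear_change_lower m (a : R) (c : 'cV[R]_m) : a != 0 ->
  linear_change (block_mx a%:M 0 c 1%:M : 'M[R]_(1 + m)).
Proof.
move=> a0 g g0 mg; rewrite det_lblock det1 mulr1 det_scalar1 /= add0n.
pose h (x : R) s := g (a * x + (vec m s *m c) 0 0 :: s).
transitivity (\int[@lebesgue_measure R]_x iint m (h x))%E.
  apply: eq_integral => x _; apply: eq_iint => s sm; congr g.
  rewrite lst_cons vec_cons mul_row_block !mulmx0 mulmx1 add0r row_mxKr vecK//.
  congr (_ :: _).
  rewrite mxE; case: splitP => // j _.
  by rewrite !ord1 mul_scalar_mx !mxE/= mulr1n mulrC.
have mh : jmeas m (h : mR -> _).
  have mc : jmeas m (fun (x : mR) s => a * x + (vec m s *m c) 0 0 : mR).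
    apply: jmeasD; first apply: jmeasM.
    - exact: jmeas_cst.
    - exact: jmeas_param.
    - by apply: jmeas_mulmx => j; exact: jmeas_vec.
  have mg' : jmeas m (fun (x : mR) s => g (x :: s)) by apply/meas1_cons.
  have := jmeas_subst (c := fun (_ : mR) s i => nth 0 s i) mg' mc
    (fun i _ => jmeas_nth _ _ _).
  apply: jmeas_ext => t s sm /=.
  by rewrite /h (_ : [seq s`_i | i <- iota 0 m] = s)// -[RHS](mkseq_nth 0 s) sm.
rewrite (iint_exchange (h := h))//; last by move=> *; exact: g0.
have -> : (\int[@lebesgue_measure R]_x iint m (fun s => g (x :: s)) =
  iint m (fun s => \int[@lebesgue_measure R]_x g (x :: s)))%E.
  rewrite (iint_exchange (h := fun x s => g (x :: s)))//.
  exact/meas1_cons.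
rewrite -iintZl//.
- apply: eq_iint => s sm.
  rewrite /h (@ge0_integral_affine a _ (fun x => g (x :: s)))//.
  by have /meas1_cons/(jmeas_section sm) := mg.
- by move=> s; apply: integral_ge0.
- exact: (@jmeas_integral R m _ mR (fun _ x s => g (x :: s))).
Qed.

(** Block elimination. A matrix with nonzero corner is a product of a lower shear, a block
    containing the Schur complement [S], and an upper shear; induction covers [S]. A zero corner is
    first made nonzero by a column operation. *)
Lemma linear_change_unitmx m (A : 'M[R]_m) : A \in unitmx -> linear_change A.
Proof.
elim: m A => [|m IH] A Au.
  move=> g g0 mg; rewrite (_ : A = 1%:M); last by rewrite flatmx0 [RHS]flatmx0.
  by rewrite det1 normr1 invr1 mul1e; apply: eq_iint => s sm; rewrite mulmx1 vecK.
have hA (B : 'M[R]_(1 + m)) : B \in unitmx -> B 0 0 != 0 -> linear_change B.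
  move=> Bu B00.
  pose a := B 0 0; pose b := ursubmx B; pose c := dlsubmx B; pose C := drsubmx B.
  pose S := C - a^-1 *: (c *m b).
  have E1 : B = block_mx a%:M 0 c S *m block_mx 1%:M (a^-1 *: b) 0 1%:M.
    rewrite mulmx_block !mulmx0 !mul0mx !mulmx1 !addr0 -scalemxAr mul_scalar_mx.
    rewrite scalerA mulVf// scale1r /S addrC -scalemxAr subrK -[LHS]submxK.
    congr block_mx; apply/rowP => i; rewrite !ord1 !mxE mulr1n /a.
    by congr (B _ _); apply/val_inj.
  have E2 : block_mx a%:M 0 c S = block_mx a%:M 0 c 1%:M *m block_mx 1%:M 0 0 S.
    by rewrite mulmx_block !mulmx0 !mul0mx !mulmx1 !mul1mx !addr0 add0r.
  have Su : S \in unitmx.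
    move: Bu; rewrite E1 unitmx_mul => /andP[+ _].
    by rewrite !unitmxE det_lblock unitrM => /andP[_].
  rewrite E1 E2; apply: linear_changeM; first apply: linear_changeM.
  - exact: linear_change_lower.
  - by apply: linear_change_block; exact: IH.
  - exact: linear_change_upper.
have [A00|A00] := eqVneq (A 0 0) 0; last exact: hA.
have [j Aj] : exists j : 'I_m, (A : 'M[R]_(1 + m)) 0 (rshift 1 j) != 0.
  apply/existsP; apply: contraT; rewrite negb_exists => /forallP A0.
  move: Au; rewrite unitmxE (expand_det_row _ 0) big1 ?unitr0// => i _.
  case: (split_ordP (i : 'I_(1 + m))) => k ->.
    rewrite (_ : lshift m k = 0) ?A00 ?mul0r//; apply/val_inj.
    by rewrite /= ord1.
  by have := A0 k; rewrite negbK => /eqP ->; rewrite mul0r.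
(* Right multiplication by [E x] adds [x] times the column of [j] to the first column, and [E (- 1)]
   undoes [E 1]. *)
pose E (x : R) : 'M[R]_(1 + m) := block_mx 1%:M 0 (x *: delta_mx j 0) 1%:M.
have EE : E 1 *m E (- 1) = 1%:M.
  rewrite /E mulmx_block !mulmx0 !mul0mx !mulmx1 !mul1mx !addr0 add0r.
  by rewrite scale1r scaleN1r subrr -scalar_mx_block.
have -> : A = (A : 'M[R]_(1 + m)) *m E 1 *m E (- 1) by rewrite -mulmxA EE mulmx1.
apply: linear_changeM; last first.
  by apply: linear_change_lower; exact: oner_neq0.
apply: hA.
  rewrite unitmx_mul Au /= unitmxE /E det_lblock !det1 mulr1; exact: unitr1.
have -> : (A *m E 1) 0 0 = A 0 0 + (A : 'M[R]_(1 + m)) 0 (rshift 1 j).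
  rewrite mxE (@big_split_ord _ _ _ 1 m) /= big_ord1.
  have z : (0 : 'I_(1 + m)) = lshift m 0 by exact/val_inj.
  have -> : E 1 (lshift m 0) 0 = 1 by rewrite [in LHS]z /E block_mxEul mxE.
  rewrite mulr1; congr (_ + _); first by rewrite -z.
  rewrite (bigD1 j)//= big1 => [|i ij].
    by rewrite [in E _ _ _]z /E block_mxEdl !mxE !eqxx mulr1 mulr1 addr0.
  by rewrite [in E _ _ _]z /E block_mxEdl !mxE (negbTE ij) mulr0 mulr0.
by rewrite A00 add0r.
Qed.

End LinearChange.

(** * Bounded functions on the cube *)

Section BoundedIntegrals.
Variable R : realType.
Local Notation mR := (measurableTypeR R).

Definition rmeas m (g : seq R -> R) := jmeas m (fun (_ : mR) s => g s : mR).

Lemma rmeas_EFin m g : rmeas m g -> meas1 m (fun s => (g s)%:E).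
Proof.
by move=> mg; apply: (jmeas_comp (f := fun r : mR => r%:E) _ mg); exact/measurable_EFinP.
Qed.

Lemma rmeas_ext m g g' : (forall s, size s = m -> g s = g' s) ->
  rmeas m g -> rmeas m g'.
Proof. by move=> gg'; apply: jmeas_ext => _ s sm; exact: gg'. Qed.

Lemma rmeas_cst m c : rmeas m (fun _ => c).
Proof. exact: (jmeas_cst _ _ (c : mR)). Qed.

Lemma rmeas_nth m i : rmeas m (fun s => nth 0 s i).
Proof. exact: jmeas_nth. Qed.

Lemma rmeasD m g g' : rmeas m g -> rmeas m g' -> rmeas m (fun s => g s + g' s).
Proof. exact: jmeasD. Qed.

Lemma rmeasM m g g' : rmeas m g -> rmeas m g' -> rmeas m (fun s => g s * g' s).
Proof. exact: jmeasM. Qed.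

Lemma rmeas_comp m (f : R -> R) g : measurable_fun [set: mR] (f : mR -> mR) ->
  rmeas m g -> rmeas m (fun s => f (g s)).
Proof. by move=> mf; exact: jmeas_comp. Qed.

Lemma rmeas_lst m m' (g : seq R -> R) (f : seq R -> 'rV[R]_m) :
  rmeas m g -> (forall i, rmeas m' (fun s => f s 0 i)) ->
  rmeas m' (fun s => g (lst (f s))).
Proof.
move=> mg mf.
have mc i : (i < m)%N -> rmeas m' (fun s => nth 0 (lst (f s)) i).
  move=> im; apply: rmeas_ext (mf (Ordinal im)) => s _.
  by rewrite -(nth_lst _ (Ordinal im)).
have := jmeas_subst mg (jmeas_cst m' _ (0 : mR)) mc.
by apply: jmeas_ext => t s _; congr g; rewrite -[RHS](mkseq_nth 0) size_lst.
Qed.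

Lemma rmeas_slice m (g : seq R -> R) x :
  rmeas m.+1 g -> rmeas m (fun s => g (x :: s)).
Proof.
move=> mg; rewrite /rmeas.
exact: (jmeas_reparam (tau := cst (0 : mR, x : mR)) mg (measurable_cst _)).
Qed.

(** Cubes suit iterated integrals because their indicator is a product. They bound integrands from
    above in [cubic] and integrals from below in [iint_gt0_box]. *)
Fixpoint box (c : seq R) (e : R) (s : seq R) : bool :=
  match c, s with
  | a :: c', t :: s' => (`|t - a| <= e) && box c' e s'
  | _, _ => true
  end.

Lemma measurable_near (a e : R) :
  measurable_fun [set: mR] (fun t : mR => (`|t - a| <= e)%R%:R : mR).
Proof.
have -> : (fun t : mR => (`|t - a| <= e)%R%:R : mR) =
    \1_(`[a - e, a + e]%classic : set mR).
  apply/funext => t; rewrite indicE; congr (_%:R).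
  by rewrite mem_setE in_itv/= ler_distl.
exact: measurable_indic.
Qed.

Lemma rmeas_box m c e : rmeas m (fun s => (box c e s)%:R).
Proof.
elim: m c => [|m IH] [|a c]; [exact: rmeas_cst|exact: measurable_cst|
  exact: rmeas_cst|].
rewrite /rmeas /=.
have m1 : measurable_fun [set: mR * mR]
  (fun p : mR * mR => (`|p.2 - a| <= e)%R%:R : mR).
  exact: (measurableT_comp (measurable_near a e) measurable_snd).
have m2 := jmeas_reparam (IH c) (measurable_cst (0 : mR) : measurable_fun [set: mR * mR] _).
have := jmeasM (jmeas_param m m1) m2.
by apply: jmeas_ext => p s _; rewrite -natrM mulnb.
Qed.

Lemma iint_box m c e : size c = m -> 0 <= e ->
  iint m (fun s => (box c e s)%:R%:E) = ((2 * e) ^+ m)%:E.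
Proof.
move=> + e0; elim: m c => [|m IH] [|a c]//= [cm].
transitivity (\int[@lebesgue_measure R]_x
   (((2 * e) ^+ m)%:E * (\1_(`[a - e, a + e]%classic : set mR) x)%:E))%E.
  apply: eq_integral => x _; rewrite indicE mem_setE in_itv/= -ler_distl muleC.
  rewrite -(IH c cm) -iintZl//; last exact/rmeas_EFin/rmeas_box.
  by apply: eq_iint => s _; rewrite -EFinM -natrM mulnb.
rewrite ge0_integralZl_EFin//; last 2 first.
- by apply/measurable_EFinP; exact: measurable_indic.
- by rewrite exprn_ge0// mulr_ge0.
rewrite integral_indic//= setIT lebesgue_measure_itv/= lte_fin.
rewrite exprSr EFinM; congr (_ * _)%E.
have [h|h] := ltP (a - e) (a + e); first by rewrite -EFinD; congr EFin; lra.
by congr EFin; lra.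
Qed.

(* This domination passes to slices, so that all partial integrals are finite. *)
Definition cubic m (C : R) (b : seq R -> R) :=
  rmeas m b /\ forall s, 0 <= b s <= C * (box (nseq m 0) 1 s)%:R.

Lemma cubic_slice m C b x : 0 <= C -> cubic m.+1 C b -> cubic m C (fun s => b (x :: s)).
Proof.
move=> C0 [mb bb]; split; first exact: rmeas_slice.
move=> s; have /andP[-> /= bC] := bb (x :: s); apply: le_trans bC _.
by rewrite ler_wpM2l// ler_nat /=; case: (_ <= 1).
Qed.

Lemma cubic_lty m C b : 0 <= C -> cubic m C b ->
  (iint m (fun s => (b s)%:E) < +oo)%E.
Proof.
move=> C0 [mb bb].
apply: (@le_lt_trans _ _ (iint m (fun s => (C%:E * (box (nseq m 0) 1 s)%:R%:E)%E))).
  apply: le_iint => [s| | |s _].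
  - by rewrite lee_fin; have /andP[] := bb s.
  - exact: rmeas_EFin.
  - rewrite (_ : (fun s => _) = fun s => (C * (box (nseq m 0) 1 s)%:R)%:E).
      by apply/rmeas_EFin/rmeasM; [exact: rmeas_cst|exact: rmeas_box].
    by apply/funext => s; rewrite EFinM.
  - by rewrite -EFinM lee_fin; have /andP[] := bb s.
rewrite iintZl//; last by apply/rmeas_EFin; exact: rmeas_box.
by rewrite iint_box ?size_nseq// -EFinM ltry.
Qed.

Lemma cubic_integrable m C b : 0 <= C -> cubic m.+1 C b ->
  (@lebesgue_measure R).-integrable [set: mR]
    (fun x => iint m (fun s => (b (x :: s))%:E)).
Proof.
move=> C0 [mb bb].
have b0 s : (0 <= (b s)%:E)%E by rewrite lee_fin; have /andP[] := bb s.
apply/integrableP; split.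
  exact: (measurable_iint_cons b0 (rmeas_EFin mb)).
rewrite (_ : (fun x => _) = (fun x => iint m (fun s => (b (x :: s))%:E))).
  exact: (@cubic_lty m.+1 C).
by apply/funext => x; rewrite gee0_abs// iint_ge0.
Qed.

(** For a signed integrand every level of the nested integral has to be split. Domination by a cube
    makes both partial integrals integrable at each level, so that they may be subtracted. *)
Lemma iint_signed m C C' (g b : seq R -> R) : 0 <= C -> 0 <= C' -> cubic m C b ->
  cubic m C' (fun s => g s + b s) ->
  iint m (fun s => (g s)%:E) =
    (iint m (fun s => (g s + b s)%:E) - iint m (fun s => (b s)%:E))%E.
Proof.
move=> C0 C'0; elim: m g b => [|m IH] g b cb cg.
  by rewrite /= -EFinB addrK.
rewrite /= -integralB//; last 2 first.
- exact: (cubic_integrable C'0 cg).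
- exact: (cubic_integrable C0 cb).
apply: eq_integral => x _; apply: IH; first exact: cubic_slice.
exact: (cubic_slice _ _ cg).
Qed.

End BoundedIntegrals.

(** * Integration over the sphere *)

Section SphereIntegral.
Variable R : realType.
Local Notation mR := (measurableTypeR R).
Implicit Types (x s : seq R) (F G : seq R -> R).

Lemma sqn_ge0 x : 0 <= sqn x.
Proof. by apply: sumr_ge0 => t _; exact: sqr_ge0. Qed.

Lemma sqn_sum n x : size x = n -> sqn x = \sum_(i < n) nth 0 x i ^+ 2.
Proof. by move=> <-; rewrite /sqn (big_nth 0) big_mkord. Qed.

Lemma sqn_cons t x : sqn (t :: x) = t ^+ 2 + sqn x.
Proof. by rewrite /sqn big_cons. Qed.

Lemma sqn_vec n x : size x = n -> sqn x = (vec n x *m (vec n x)^T) 0 0.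
Proof.
by move/sqn_sum => ->; rewrite mxE; apply: eq_bigr => i _; rewrite !mxE.
Qed.

Lemma sqn_lst n (v : 'rV[R]_n) : sqn (lst v) = (v *m v^T) 0 0.
Proof. by rewrite (sqn_vec (size_lst v)) lstK. Qed.

Lemma size_radial x : size (radial x) = size x.
Proof. by rewrite size_map. Qed.

Lemma nth_radial x i : nth 0 (radial x) i = nth 0 x i / Num.sqrt (sqn x).
Proof.
have [ix|xi] := ltnP i (size x); first by rewrite (nth_map 0).
by rewrite !nth_default ?size_radial// mul0r.
Qed.

Lemma radial_lst n x : size x = n ->
  radial x = lst ((Num.sqrt (sqn x))^-1 *: vec n x).
Proof.
move=> xn; apply: (@eq_from_nth _ 0); rewrite size_radial ?size_lst// xn => i im.
by rewrite nth_radial (nth_lst _ (Ordinal im)) !mxE mulrC.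
Qed.

Lemma sqn_radial x : sqn x != 0 -> sqn (radial x) = 1.
Proof.
move=> x0; rewrite {1}/sqn big_map.
under eq_bigr do rewrite exprMn exprVn sqr_sqrtr ?sqn_ge0//.
by rewrite -mulr_suml divff.
Qed.

Lemma rmeas_sqn n : rmeas n (@sqn R).
Proof.
apply: (@rmeas_ext _ _ (fun s => \sum_(i < n) nth 0 s i * nth 0 s i)).
  by move=> s /sqn_sum ->; apply: eq_bigr => i _; rewrite expr2.
apply: (jmeas_sum (index_enum 'I_n) xpredT
  (f := fun (i : 'I_n) (_ : mR) s => nth 0 s i * nth 0 s i : mR)) => i.
by apply: rmeasM; exact: rmeas_nth.
Qed.

Lemma rmeas_nth_radial n i : rmeas n (fun x => nth 0 (radial x) i).
Proof.
(* The factor 1/|x| is written as a real power of |x|^2, a measurable function on the whole line. *)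
apply: (@rmeas_ext _ _ (fun x => nth 0 x i * (sqn x `^ (- 2^-1)))) => [x _|].
  by rewrite nth_radial powRN powR12_sqrt// sqn_ge0.
apply: rmeasM; first exact: rmeas_nth.
apply: (@rmeas_comp _ _ (@powR R ^~ (- 2^-1))); last exact: rmeas_sqn.
exact: measurable_powR.
Qed.

Lemma unit_nth x i : sqn x <= 1 -> `|nth 0 x i| <= 1.
Proof.
move=> x1; have [ix|xi] := ltnP i (size x); last first.
  by rewrite nth_default// normr0.
rewrite -(@ler_pXn2r _ 2)// ?nnegrE// expr1n real_normK ?num_real//.
apply: le_trans x1; rewrite (sqn_sum erefl) (bigD1 (Ordinal ix))//=.
by rewrite lerDl sumr_ge0// => j _; exact: sqr_ge0.
Qed.

Lemma radial_nth x i : `|nth 0 (radial x) i| <= 1.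
Proof.
have [x0|x0] := eqVneq (sqn x) 0; last by rewrite unit_nth// sqn_radial.
by rewrite nth_radial x0 sqrtr0 invr0 mulr0 normr0.
Qed.

Section Ball.
Variable n : nat.

(** The length test makes [weight F] vanish on lists of the wrong length, where nothing is known
    about [F], whereas [cubic] asks for bounds on all lists. *)
Definition ballf x : R := ((size x == n) && (sqn x <= 1))%:R.

Lemma rmeas_ballf : rmeas n ballf.
Proof.
apply: (@rmeas_ext _ _ (fun s => \1_(`]-oo, 1]%classic : set mR) (sqn s))).
  by move=> s sn; rewrite indicE mem_setE in_itv/= /ballf sn eqxx.
apply: (@rmeas_comp _ _ (\1_(`]-oo, 1]%classic : set mR))); last exact: rmeas_sqn.
exact: measurable_indic.
Qed.

Lemma box_nseq0 e s : size s = n -> box (nseq n 0) e s = all (fun t => `|t| <= e) s.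
Proof. by move=> <-; elim: s => //= t s ->; rewrite subr0. Qed.

Lemma cubic_ballf : cubic n 1 ballf.
Proof.
split; first exact: rmeas_ballf.
move=> s; rewrite /ballf ler0n mul1r /= ler_nat.
case: eqP => //= sn; case: (boolP (sqn s <= 1)) => // s1.
rewrite (_ : box _ _ _)// box_nseq0//; apply/allP => t /(nthP 0)[i _ <-].
exact: unit_nth.
Qed.

Lemma in_unit_ball s : (s \in @unit_ball R) = (sqn s <= 1).
Proof. by apply/idP/idP => [/set_mem|/mem_set]. Qed.

Lemma lebm_ball : lebm n (@unit_ball R) = iint n (fun x => (ballf x)%:E).
Proof.
by apply: eq_iint => s sn; rewrite indicE in_unit_ball /ballf sn eqxx.
Qed.

Lemma iint_gt0_box (h : seq R -> R) c e (d : R) : 0 < e -> 0 < d -> size c = n ->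
  (forall s, 0 <= h s) -> rmeas n h ->
  (forall s, size s = n -> box c e s -> d <= h s) ->
  (0 < iint n (fun s => (h s)%:E))%E.
Proof.
move=> e0 d0 cn h0 mh hd.
apply: (@lt_le_trans _ _ (iint n (fun s => (d%:E * (box c e s)%:R%:E)%E))).
  rewrite iintZl ?(ltW d0)//; last exact/rmeas_EFin/rmeas_box.
  by rewrite iint_box ?(ltW e0)// -EFinM lte_fin mulr_gt0// exprn_gt0// mulr_gt0.
apply: le_iint => [s| | |s sn].
- by rewrite -EFinM lee_fin mulr_ge0// ltW.
- rewrite (_ : (fun s => _) = fun s => (d * (box c e s)%:R)%:E).
    by apply/rmeas_EFin/rmeasM; [exact: rmeas_cst|exact: rmeas_box].
  by apply/funext => s; rewrite EFinM.
- exact: rmeas_EFin.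
- rewrite -EFinM lee_fin; case: (boolP (box c e s)) => [bs|_].
    by rewrite mulr1 hd.
  by rewrite mulr0.
Qed.

Definition ball_vol : R := fine (lebm n (@unit_ball R)).

Lemma ball_volE : lebm n (@unit_ball R) = ball_vol%:E.
Proof.
rewrite /ball_vol fineK// lebm_ball ge0_fin_numE.
  by apply: (cubic_lty (C := 1)) => //; exact: cubic_ballf.
by apply: iint_ge0 => s; rewrite lee_fin ler0n.
Qed.

Lemma ball_vol_gt0 : 0 < ball_vol.
Proof.
rewrite -lte_fin -ball_volE lebm_ball.
(* The cube of half-width 1/(n+1) lies in the ball: each of the n squares is at most 1/(n+1). The
   shift by one also covers n = 0. *)
have e0 : (0 : R) < n.+1%:R^-1 by rewrite invr_gt0.
apply: (iint_gt0_box e0 (@ltr01 R) (size_nseq n 0)).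
- by move=> s; rewrite ler0n.
- exact: rmeas_ballf.
- move=> s sn; rewrite box_nseq0// => /allP hs.
  rewrite /ballf sn eqxx /= (_ : sqn s <= 1)//.
  rewrite (sqn_sum sn).
  apply: (@le_trans _ _ (\sum_(i < n) (n.+1%:R^-1))).
    apply: ler_sum => i _.
    have : `|nth 0 s i| <= n.+1%:R^-1 by apply: hs; rewrite mem_nth// sn.
    move=> h; rewrite -real_normK ?num_real// expr2.
    apply: (@le_trans _ _ (1 * `|nth 0 s i|)); last by rewrite mul1r.
    rewrite ler_wpM2r//; apply: le_trans h _.
    by rewrite invf_le1// ler1n.
  rewrite sumr_const card_ord -[leLHS]mulr_natl ler_pdivrMr// mul1r ler_nat.
  exact: leqnSn.
Qed.

Definition weight F x := ballf x * F (radial x).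

Lemma sphere_intE F :
  sphere_int n F = fine (iint n (fun x => (weight F x)%:E)) / ball_vol.
Proof.
congr (fine _ / _); apply: eq_iint => x xn.
by rewrite /weight indicE in_unit_ball /ballf xn eqxx.
Qed.

(* Boundedness is also needed at the junk value [radial 0 = 0]. *)
Definition sbounded C F := rmeas n (fun x => F (radial x)) /\
  (forall x, size x = n -> `|F (radial x)| <= C).

Definition snonneg F := forall x, size x = n -> 0 <= F (radial x).

Lemma sbounded_ge0 C F : sbounded C F -> 0 <= C.
Proof. by move=> [_ /(_ _ (size_nseq n 0))]; exact: le_trans. Qed.

Lemma weight_ge0 F x : snonneg F -> 0 <= weight F x.
Proof.
move=> F0; rewrite /weight /ballf; case: eqP => [/F0 h|_].
  by rewrite mulr_ge0.
by rewrite mul0r.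
Qed.

Lemma cubic_weight C F : sbounded C F -> snonneg F -> cubic n C (weight F).
Proof.
move=> FC F0; have C0 := sbounded_ge0 FC; have [mF bF] := FC; split.
  by apply: rmeasM => //; exact: rmeas_ballf.
move=> s; rewrite weight_ge0//=; have [_ /(_ s)/andP[b0 b1]] := cubic_ballf.
rewrite mul1r in b1; apply: le_trans (ler_wpM2l C0 b1).
rewrite /weight mulrC; move: b0; rewrite /ballf; case: eqP => [sn|_] b0.
  by rewrite ler_wpM2r// (le_trans (ler_norm _))// bF.
by rewrite !mulr0.
Qed.

Definition wint F := iint n (fun x => (weight F x)%:E).

Lemma wint_fin C F : sbounded C F -> snonneg F -> wint F \is a fin_num.
Proof.
move=> FC F0; rewrite ge0_fin_numE.
  exact: (cubic_lty (sbounded_ge0 FC) (cubic_weight FC F0)).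
by apply: iint_ge0 => s; rewrite lee_fin weight_ge0.
Qed.

Lemma wintD C D F G : sbounded C F -> snonneg F -> sbounded D G -> snonneg G ->
  wint (fun x => F x + G x) = (wint F + wint G)%E.
Proof.
move=> FC F0 GD G0; rewrite /wint -iintD.
- by apply: eq_iint => s _; rewrite -EFinD /weight mulrDr.
- by move=> s; rewrite lee_fin weight_ge0.
- by have [? _] := cubic_weight FC F0; exact: rmeas_EFin.
- by move=> s; rewrite lee_fin weight_ge0.
- by have [? _] := cubic_weight GD G0; exact: rmeas_EFin.
Qed.

Lemma sphere_intD_ge0 C D F G :
  sbounded C F -> snonneg F -> sbounded D G -> snonneg G ->
  sphere_int n (fun x => F x + G x) = sphere_int n F + sphere_int n G.
Proof.
move=> FC F0 GD G0; rewrite !sphere_intE -mulrDl; congr (_ / _).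
rewrite -[X in fine X]/(wint (fun x => F x + G x)) (wintD FC F0 GD G0).
by rewrite fineD// (wint_fin FC F0, wint_fin GD G0).
Qed.

Lemma sbounded_cst (c : R) : 0 <= c -> sbounded c (fun _ => c).
Proof. by move=> c0; split=> [|x _]; [exact: rmeas_cst|rewrite ger0_norm]. Qed.

Lemma sboundedD C D F G : sbounded C F -> sbounded D G ->
  sbounded (C + D) (fun x => F x + G x).
Proof.
move=> [mF bF] [mG bG]; split; first exact: rmeasD.
by move=> x xn; apply: le_trans (ler_normD _ _) _; rewrite lerD ?bF ?bG.
Qed.

Lemma sboundedM C D F G : sbounded C F -> sbounded D G ->
  sbounded (C * D) (fun x => F x * G x).
Proof.
move=> [mF bF] [mG bG]; split; first exact: rmeasM.
by move=> x xn; rewrite normrM ler_pM ?bF ?bG.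
Qed.

Lemma sphere_int_cst_ge0 (c : R) : 0 <= c -> sphere_int n (fun _ => c) = c.
Proof.
move=> c0.
rewrite sphere_intE (_ : iint n _ = (c%:E * lebm n (@unit_ball R))%E); last first.
  rewrite lebm_ball -iintZl//; last exact/rmeas_EFin/rmeas_ballf.
    by apply: eq_iint => s _; rewrite -EFinM /weight mulrC.
  by move=> s; rewrite lee_fin ler0n.
by rewrite ball_volE /= mulfK// gt_eqF// ball_vol_gt0.
Qed.

Lemma snonneg_shift C F : sbounded C F -> snonneg (fun x => F x + C).
Proof.
by move=> [_ bF] x xn; have := bF _ xn; rewrite ler_norml => /andP[? _]; lra.
Qed.

(** Reduces a bounded signed function to a nonnegative one, for which additivity, scaling and linear
    changes of variables hold. *)
Lemma sphere_int_shift C F : sbounded C F ->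
  sphere_int n F = sphere_int n (fun x => F x + C) - C.
Proof.
move=> FC; have C0 := sbounded_ge0 FC; have cC := sbounded_cst C0.
have FCn := snonneg_shift FC; have FCb := sboundedD FC cC.
have c0 : snonneg (fun _ => C) by [].
rewrite -[X in _ - X](sphere_int_cst_ge0 C0) !sphere_intE -mulrBl; congr (_ / _).
rewrite (iint_signed (C := C) (C' := C + C) (b := weight (fun _ => C)))//; last 3 first.
- exact: addr_ge0.
- exact: cubic_weight.
- rewrite (_ : (fun s => _) = weight (fun x => F x + C)); first exact: cubic_weight.
  by apply/funext => s; rewrite /weight mulrDr.
rewrite -fineB//; [congr (fine (_ - _)) | | exact: (wint_fin cC c0)].
  by apply: eq_iint => s _; rewrite /weight mulrDr.
exact: (wint_fin FCb FCn).
Qed.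

Lemma sphere_int_cst (c : R) : sphere_int n (fun _ => c) = c.
Proof.
have cb : sbounded `|c| (fun _ => c) by split=> //; exact: rmeas_cst.
rewrite (sphere_int_shift cb) sphere_int_cst_ge0 ?addrK//.
by have := ler_norm (- c); rewrite normrN; lra.
Qed.

Lemma sphere_intD C D F G : sbounded C F -> sbounded D G ->
  sphere_int n (fun x => F x + G x) = sphere_int n F + sphere_int n G.
Proof.
move=> FC GD; have cC := sbounded_cst (sbounded_ge0 FC).
have cD := sbounded_cst (sbounded_ge0 GD).
rewrite (sphere_int_shift (sboundedD FC GD)) (sphere_int_shift FC).
rewrite (sphere_int_shift GD) addrACA -opprD; congr (_ - _).
rewrite -(sphere_intD_ge0 (sboundedD FC cC) (snonneg_shift FC)
  (sboundedD GD cD) (snonneg_shift GD)).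
by congr (sphere_int _ _); apply/funext => x; rewrite addrACA.
Qed.

Lemma sboundedZ C k F : sbounded C F -> sbounded (`|k| * C) (fun x => k * F x).
Proof.
move=> [mF bF]; split; first by apply: rmeasM => //; exact: rmeas_cst.
by move=> x xn; rewrite normrM ler_wpM2l// bF.
Qed.

Lemma sphere_intZ_ge0 C k F : 0 <= k -> sbounded C F -> snonneg F ->
  sphere_int n (fun x => k * F x) = k * sphere_int n F.
Proof.
move=> k0 FC F0; rewrite !sphere_intE mulrA; congr (_ / _).
transitivity (fine (k%:E * wint F)%E); last first.
  by have := wint_fin FC F0; rewrite -[in X in _ -> X](fineK (wint_fin FC F0)).
rewrite /wint -iintZl//.
- by congr fine; apply: eq_iint => s _; rewrite -EFinM /weight mulrCA.
- by move=> s; rewrite lee_fin weight_ge0.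
- by have [? _] := cubic_weight FC F0; exact: rmeas_EFin.
Qed.

Lemma sphere_intZ C k F : sbounded C F ->
  sphere_int n (fun x => k * F x) = k * sphere_int n F.
Proof.
move=> FC.
have pos k' : 0 <= k' -> sphere_int n (fun x => k' * F x) = k' * sphere_int n F.
  move=> k0; have C0 := sbounded_ge0 FC; have cC := sbounded_cst C0.
  rewrite (sphere_int_shift FC) mulrBr -(sphere_intZ_ge0 k0 (sboundedD FC cC) (snonneg_shift FC)).
  have -> : (fun x => k' * (F x + C)) = (fun x => k' * F x + k' * C).
    by apply/funext => x; rewrite mulrDr.
  rewrite (sphere_intD (sboundedZ k' FC) (sbounded_cst (mulr_ge0 k0 C0))).
  by rewrite sphere_int_cst addrK.
have [/pos//|k0] := leP 0 k.
(* For negative [k], the integrals of k F and (-k) F add up to zero, and the second one is already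
   known. *)
apply/eqP; rewrite -subr_eq0 -[k in X in _ - X]opprK mulNr opprK -pos ?oppr_ge0 ?ltW//.
rewrite -(sphere_intD (sboundedZ k FC) (sboundedZ (- k) FC)).
rewrite (_ : (fun x => _) = fun _ => 0) ?sphere_int_cst//.
by apply/funext => x; rewrite mulNr subrr.
Qed.

Lemma sbounded_sum I (r : seq I) (F : I -> seq R -> R) (C : I -> R) :
  (forall i, sbounded (C i) (F i)) ->
  sbounded (\sum_(i <- r) C i) (fun x => \sum_(i <- r) F i x).
Proof.
move=> FC; elim: r => [|i r IH].
  rewrite big_nil (_ : (fun x => _) = (fun => 0)); first exact: sbounded_cst.
  by apply/funext => x; rewrite big_nil.
rewrite big_cons (_ : (fun x => _) = (fun x => F i x + \sum_(i <- r) F i x)).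
  exact: sboundedD.
by apply/funext => x; rewrite big_cons.
Qed.

Lemma sphere_int_sum I (r : seq I) (F : I -> seq R -> R) (C : I -> R) :
  (forall i, sbounded (C i) (F i)) ->
  sphere_int n (fun x => \sum_(i <- r) F i x) =
  \sum_(i <- r) sphere_int n (F i).
Proof.
move=> FC; elim: r => [|i r IH].
  rewrite big_nil (_ : (fun x => _) = (fun => 0)); first exact: sphere_int_cst.
  by apply/funext => x; rewrite big_nil.
rewrite big_cons -IH -(sphere_intD (FC i) (sbounded_sum r FC)).
by congr (sphere_int n _); apply/funext => x; rewrite big_cons.
Qed.

Lemma sphere_int_ge0 F : snonneg F -> 0 <= sphere_int n F.
Proof.
move=> F0; rewrite sphere_intE divr_ge0 ?(ltW ball_vol_gt0)// fine_ge0//.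
by apply: iint_ge0 => s; rewrite lee_fin weight_ge0.
Qed.

Lemma sphere_int_gt0 C F c e d : sbounded C F -> snonneg F ->
  0 < e -> 0 < d -> size c = n ->
  (forall s, size s = n -> box c e s -> sqn s <= 1 /\ d <= F (radial s)) ->
  0 < sphere_int n F.
Proof.
move=> FC F0 e0 d0 cn h; rewrite sphere_intE divr_gt0 ?ball_vol_gt0//.
apply: fine_gt0; apply/andP; split.
  apply: (iint_gt0_box e0 d0 cn) => [s| |s sn /(h _ sn)[s1 ds]].
  - exact: weight_ge0.
  - by have [] := cubic_weight FC F0.
  - by rewrite /weight /ballf sn eqxx s1 mul1r.
exact: (cubic_lty (sbounded_ge0 FC) (cubic_weight FC F0)).
Qed.

(** An orthogonal map preserves the ball, commutes with [radial] and has determinant of absolute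
    value one. *)
Lemma sphere_int_orthogonal C F (U : 'M[R]_n) : U *m U^T = 1%:M ->
  sbounded C F -> sphere_int n (fun x => F (lst (vec n x *m U))) = sphere_int n F.
Proof.
move=> UU FC.
have sqU v : sqn (lst (v *m U)) = sqn (lst v).
  by rewrite !sqn_lst trmx_mul mulmxA -(mulmxA v) UU mulmx1.
have radU x : size x = n -> radial (lst (vec n x *m U)) = lst (vec n (radial x) *m U).
  move=> xn; rewrite (radial_lst (size_lst _)) sqU !lstK vecK// (radial_lst xn) lstK.
  by rewrite scalemxAl.
have FUC : sbounded C (fun x => F (lst (vec n x *m U))).
  split; last first.
    by move=> x xn; rewrite -radU//; apply: FC.2; rewrite size_lst.
  apply: (@rmeas_ext _ _ (fun x => F (radial (lst (vec n x *m U))))).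
    by move=> x xn; rewrite radU.
  apply: (rmeas_lst (g := fun x => F (radial x))) FC.1 _ => i.
  by apply: jmeas_mulmx => j; exact: jmeas_vec.
rewrite (sphere_int_shift FUC) (sphere_int_shift FC); congr (_ - _).
rewrite !sphere_intE; congr (fine _ / _).
have cC := sbounded_cst (sbounded_ge0 FC).
have FCn := snonneg_shift FC; have FCb := sboundedD FC cC.
have Uu : U \in unitmx by have [] := mulmx1_unit UU.
have detU : `|\det U| = 1.
  have := congr1 determinant UU; rewrite det_mulmx det_tr det1 -expr2 => /eqP.
  by rewrite sqrf_eq1 => /pred2P[] ->; rewrite ?normrN normr1.
pose h s := (weight (fun x => F x + C) s)%:E.
transitivity (iint n (fun s => h (lst (vec n s *m U)))).
  apply: eq_iint => s sn.
  by rewrite /h /weight /ballf radU// sqU vecK// size_lst sn eqxx.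
rewrite (linear_change_unitmx Uu) ?detU ?invr1 ?mul1e//.
- by move=> s; rewrite lee_fin weight_ge0.
- by have [? _] := cubic_weight FCb FCn; exact: rmeas_EFin.
Qed.

End Ball.

(** [radial x] is on the sphere unless x = 0. The origin is avoided by deleting the single value 0
    of the first coordinate, a null set for the outermost integral; this needs at least one
    variable. *)
Lemma eq_sphere_int n C D F G : (0 < n)%N -> sbounded n C F -> sbounded n D G ->
  (forall x, size x = n -> sqn x = 1 -> F x = G x) ->
  sphere_int n F = sphere_int n G.
Proof.
case: n => // n _ FC GD FG.
(* A common bound lets both functions be shifted by the same constant. *)
wlog CD : C D FC GD / C = D => [H|].
  have C0 := sbounded_ge0 FC; have D0 := sbounded_ge0 GD.
  apply: (H (C + D) (C + D)) => //.
    by split=> [|x xn]; [exact: FC.1|apply: le_trans (FC.2 _ xn) _; rewrite lerDl].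
  by split=> [|x xn]; [exact: GD.1|apply: le_trans (GD.2 _ xn) _; rewrite lerDr].
move: CD GD => <- GD.
rewrite (sphere_int_shift FC) (sphere_int_shift GD); congr (_ - _).
have cC := sbounded_cst n.+1 (sbounded_ge0 FC).
have FCn := snonneg_shift FC; have [mF _] := cubic_weight (sboundedD FC cC) FCn.
have GDn := snonneg_shift GD; have [mG _] := cubic_weight (sboundedD GD cC) GDn.
have wm H : snonneg n.+1 H -> rmeas n.+1 (weight n.+1 H) ->
  measurable_fun [set: mR] (fun t : mR => iint n (fun s => (weight n.+1 H (t :: s))%:E)).
  move=> H0 mH; apply: (@measurable_iint_cons _ _ (fun s => (weight n.+1 H s)%:E)).
    by move=> s; rewrite lee_fin weight_ge0.
  exact: rmeas_EFin.
rewrite !sphere_intE; congr (fine _ / _) => /=.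
rewrite -[LHS](@integral_setD1 R _ 0 setT)/=; last 2 first.
- exact: measurableD.
- by apply: (@measurable_funS _ _ mR _ setT) => //; exact: wm.
rewrite -[RHS](@integral_setD1 R _ 0 setT)/=; last 2 first.
- exact: measurableD.
- by apply: (@measurable_funS _ _ mR _ setT) => //; exact: wm.
apply: eq_integral => x /set_mem[_ /eqP x0]; apply: eq_iint => s sn.
rewrite /weight FG// ?size_radial/= ?sn// sqn_radial// sqn_cons.
by rewrite gt_eqF// ltr_pwDl ?sqn_ge0// exprn_even_gt0.
Qed.

End SphereIntegral.

(** * Forms *)

Section FormAlgebra.
Variable R : realType.
Local Notation mR := (measurableTypeR R).
Variables n d : nat.
Implicit Types (f g h : pform R n d) (x s : seq R).

Lemma sum_mon (a : mon n d) : (\sum_(i < n) tnth (val a) i)%N = d.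
Proof. by have /eqP := valP a; rewrite big_tuple. Qed.

Lemma fevalD f g x : feval (f + g) x = feval f x + feval g x.
Proof.
by rewrite /feval -big_split; apply: eq_bigr => a _; rewrite ffunE mulrDl.
Qed.

Lemma fevalZ k f x : feval (k *: f) x = k * feval f x.
Proof.
by rewrite /feval mulr_sumr; apply: eq_bigr => a _; rewrite ffunE -mulrA.
Qed.

Lemma feval0 x : feval (0 : pform R n d) x = 0.
Proof. by rewrite /feval big1// => a _; rewrite ffunE mul0r. Qed.

Lemma feval_sum I (r : seq I) (P : pred I) (F : I -> pform R n d) x :
  feval (\sum_(i <- r | P i) F i) x = \sum_(i <- r | P i) feval (F i) x.
Proof.
by apply: (big_morph (fun f => feval f x)) => [f g|]; rewrite ?fevalD ?feval0.
Qed.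

(** The hypothesis is on coordinates so that it applies to [radial] and to rescaled lists and, with
    k = 0, to points whose coordinates all vanish. *)
Lemma feval_homo f k x x' : (forall i, nth 0 x' i = k * nth 0 x i) ->
  feval f x' = k ^+ d * feval f x.
Proof.
move=> xx; rewrite /feval mulr_sumr; apply: eq_bigr => a _.
rewrite mulrCA; congr (_ * _).
have -> : k ^+ d = \prod_(i < n) k ^+ tnth (val a) i by rewrite prodrXr sum_mon.
by rewrite -big_split; apply: eq_bigr => i _; rewrite xx exprMn.
Qed.

Lemma feval_radial f x : sqn x != 0 ->
  feval f x = Num.sqrt (sqn x) ^+ d * feval f (radial x).
Proof.
move=> x0; apply: feval_homo => i; rewrite nth_radial mulrC divfK//.
by rewrite sqrtr_eq0 -ltNge lt_neqAle eq_sym x0 sqn_ge0.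
Qed.

Lemma feval_sqn0 f x : (0 < d)%N -> sqn x = 0 -> feval f x = 0.
Proof.
move=> d0 x0; rewrite (@feval_homo f 0 x) ?expr0n ?gtn_eqF ?mul0r// => i.
have [ix|xi] := ltnP i (size x); last by rewrite nth_default// mul0r.
apply/eqP; rewrite mul0r -sqrf_eq0 -/(_ == 0).
move/eqP: x0; rewrite (sqn_sum erefl) psumr_eq0 => [/allP|j _]; last exact: sqr_ge0.
by move=> /(_ (Ordinal ix) (mem_index_enum _))/=.
Qed.

Definition coef_bound f := \sum_a `|f a|.

Lemma sbounded_feval f : sbounded n (coef_bound f) (feval f).
Proof.
split.
  apply: (jmeas_sum (index_enum _) xpredT (f := fun a (_ : mR) x =>
    f a * \prod_(i < n) nth 0 (radial x) i ^+ tnth (val a) i : mR)) => a.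
  apply: jmeasM; first exact: rmeas_cst.
  apply: (jmeas_prod (index_enum _) (f := fun (i : 'I_n) (_ : mR) x =>
    nth 0 (radial x) i ^+ tnth (val a) i : mR)) => i.
  elim: (nat_of_ord (tnth (val a) i)) => [|k IH]; first exact: (rmeas_cst _ 1).
  by apply: rmeas_ext (rmeasM (rmeas_nth_radial _ n i) IH) => x _; rewrite exprS.
move=> x xn; apply: le_trans (ler_norm_sum _ _ _) _; apply: ler_sum => a _.
rewrite normrM ler_piMr// normr_prod; apply: prodr_ile1 => i.
by rewrite normr_ge0 normrX exprn_ile1// radial_nth.
Qed.

Lemma sbounded_feval2 f g :
  sbounded n (coef_bound f * coef_bound g) (fun x => feval f x * feval g x).
Proof. by apply: sboundedM; exact: sbounded_feval. Qed.

Definition sint f := sphere_int n (feval f).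

Lemma sintD f g : sint (f + g) = sint f + sint g.
Proof.
rewrite -(sphere_intD (sbounded_feval f) (sbounded_feval g)).
by congr (sphere_int n _); apply/funext => x; rewrite fevalD.
Qed.

Lemma sintZ k f : sint (k *: f) = k * sint f.
Proof.
rewrite -(sphere_intZ k (sbounded_feval f)).
by congr (sphere_int n _); apply/funext => x; rewrite fevalZ.
Qed.

Lemma sipC f g : sip f g = sip g f.
Proof. by congr (sphere_int n _); apply/funext => x; rewrite mulrC. Qed.

Lemma sipDl f g h : sip (f + g) h = sip f h + sip g h.
Proof.
rewrite -(sphere_intD (sbounded_feval2 f h) (sbounded_feval2 g h)).
by congr (sphere_int n _); apply/funext => x; rewrite fevalD mulrDl.
Qed.

Lemma sipZl k f h : sip (k *: f) h = k * sip f h.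
Proof.
rewrite -(sphere_intZ k (sbounded_feval2 f h)).
by congr (sphere_int n _); apply/funext => x; rewrite fevalZ mulrA.
Qed.

Lemma sipDr f g h : sip h (f + g) = sip h f + sip h g.
Proof. by rewrite !(sipC h) sipDl. Qed.

Lemma sipZr k f h : sip h (k *: f) = k * sip h f.
Proof. by rewrite !(sipC h) sipZl. Qed.

Lemma sip0l h : sip 0 h = 0.
Proof. by rewrite -(scale0r (0 : pform R n d)) sipZl mul0r. Qed.

Lemma sipBl f g h : sip (f - g) h = sip f h - sip g h.
Proof. by rewrite sipDl -scaleN1r sipZl mulN1r. Qed.

Lemma sip_suml I (r : seq I) (P : pred I) (F : I -> pform R n d) h :
  sip (\sum_(i <- r | P i) F i) h = \sum_(i <- r | P i) sip (F i) h.
Proof.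
by apply: (big_morph (fun f => sip f h)) => [f g|]; rewrite ?sipDl ?sip0l.
Qed.

Lemma sip_sumr I (r : seq I) (P : pred I) (F : I -> pform R n d) h :
  sip h (\sum_(i <- r | P i) F i) = \sum_(i <- r | P i) sip h (F i).
Proof. by rewrite sipC sip_suml; apply: eq_bigr => i _; exact: sipC. Qed.

Lemma sint0 : sint (0 : pform R n d) = 0.
Proof. by rewrite -(scale0r (0 : pform R n d)) sintZ mul0r. Qed.

Lemma sintB f g : sint (f - g) = sint f - sint g.
Proof. by rewrite sintD -scaleN1r sintZ mulN1r. Qed.

Lemma sint_sum I (r : seq I) (P : pred I) (F : I -> pform R n d) :
  sint (\sum_(i <- r | P i) F i) = \sum_(i <- r | P i) sint (F i).
Proof.
by apply: (big_morph sint) => [f g|]; rewrite ?sintD ?sint0.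
Qed.

End FormAlgebra.

(** * Local Lipschitz estimates on cubes for polynomial functions *)

Section LocalLipschitz.
Variable R : realType.
Implicit Types (x s : seq R) (F G : seq R -> R).

(** Continuity at [x] in a form that passes to sums and products with explicit constants, and
    phrased with the cubes on which positivity of integrals is tested. *)
Definition loclip x F := exists2 K : R, 0 <= K &
  forall e s, 0 <= e <= 1 -> size s = size x -> box x e s -> `|F s - F x| <= K * e.

Lemma loclip_cst x c : loclip x (fun=> c).
Proof. by exists 0 => // e s _ _ _; rewrite subrr normr0 mul0r. Qed.

Lemma loclip_nth x i : loclip x (fun s => nth 0 s i).
Proof.
exists 1 => // e s /andP[e0 _]; rewrite mul1r.
elim: x s i => [|a x IH] [|t s] [|i]//=; rewrite ?subrr ?normr0//.
  by move=> _ /andP[].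
by move=> [sx] /andP[_ /(IH _ i sx)].
Qed.

Lemma loclipD x F G : loclip x F -> loclip x G -> loclip x (fun s => F s + G s).
Proof.
move=> [K K0 hF] [L L0 hG]; exists (K + L); first exact: addr_ge0.
move=> e s e01 sx bs; rewrite opprD addrACA (le_trans (ler_normD _ _))//.
by rewrite mulrDl lerD ?hF ?hG.
Qed.

Lemma loclipM x F G : loclip x F -> loclip x G -> loclip x (fun s => F s * G s).
Proof.
move=> [K K0 hF] [L L0 hG]; exists ((`|F x| + K) * L + `|G x| * K).
  by rewrite addr_ge0// mulr_ge0// addr_ge0.
move=> e s e01 sx bs; have [e0 e1] := andP e01.
have -> : F s * G s - F x * G x = F s * (G s - G x) + G x * (F s - F x) by ring.
rewrite (le_trans (ler_normD _ _))// mulrDl !normrM -!mulrA lerD//; last first.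
  by rewrite ler_wpM2l// hF.
apply: ler_pM => //; last exact: hG.
have := hF _ _ e01 sx bs => h.
rewrite -[F s](subrK (F x)) addrC (le_trans (ler_normD _ _))// lerD2l.
by apply: le_trans h _; rewrite -[leRHS]mulr1 ler_wpM2l.
Qed.

Lemma loclipX x F k : loclip x F -> loclip x (fun s => F s ^+ k).
Proof.
move=> hF; elim: k => [|k IH]; first exact: loclip_cst.
by under eq_fun do rewrite exprS; exact: loclipM.
Qed.

Lemma loclip_sum x I (r : seq I) (F : I -> seq R -> R) :
  (forall i, loclip x (F i)) -> loclip x (fun s => \sum_(i <- r) F i s).
Proof.
move=> hF; elim: r => [|i r IH].
  by under eq_fun do rewrite big_nil; exact: loclip_cst.
by under eq_fun do rewrite big_cons; exact: loclipD.
Qed.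

Lemma loclip_prod x I (r : seq I) (F : I -> seq R -> R) :
  (forall i, loclip x (F i)) -> loclip x (fun s => \prod_(i <- r) F i s).
Proof.
move=> hF; elim: r => [|i r IH].
  by under eq_fun do rewrite big_nil; exact: loclip_cst.
by under eq_fun do rewrite big_cons; exact: loclipM.
Qed.

Lemma loclip_feval n d (f : pform R n d) x : loclip x (feval f).
Proof.
apply: loclip_sum => a; apply: loclipM; first exact: loclip_cst.
by apply: loclip_prod => i; apply: loclipX; exact: loclip_nth.
Qed.

Lemma loclip_sqn x : loclip x (@sqn R).
Proof.
have [K K0 hK] : loclip x (fun s => \sum_(i < size x) nth 0 s i ^+ 2).
  by apply: loclip_sum => i; apply: loclipX; exact: loclip_nth.
by exists K => // e s e01 sx bs; rewrite (sqn_sum sx) (sqn_sum erefl) hK.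
Qed.

Lemma loclip_near x F eps : loclip x F -> 0 < eps ->
  exists2 e0 : R, 0 < e0 & forall e s, 0 <= e <= e0 -> size s = size x ->
    box x e s -> `|F s - F x| <= eps.
Proof.
move=> [K K0 hF] eps0; have K1 : 0 < K + 1 by apply: ltr_wpDl.
exists (Num.min 1 (eps / (K + 1))); first by rewrite lt_min ltr01 divr_gt0.
move=> e s /andP[e0]; rewrite le_min => /andP[e1 eK] sx bs.
apply: (le_trans (hF e s _ sx bs)); first by rewrite e0.
apply: (@le_trans _ _ ((K + 1) * e)); first by rewrite ler_wpM2r// lerDl.
by rewrite mulrC -ler_pdivlMr.
Qed.

End LocalLipschitz.

(** * Positive definiteness of the inner product *)

Section PositiveDefinite.
Variable R : realType.

(** Reduction modulo [B] isolates the lowest digit. It makes the exponents in Kronecker's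
    substitution distinct. *)
Lemma digits_inj (B n : nat) (a b : nat -> nat) :
  (forall i, (i < n)%N -> (a i < B)%N) -> (forall i, (i < n)%N -> (b i < B)%N) ->
  (\sum_(i < n) a i * B ^ i = \sum_(i < n) b i * B ^ i)%N ->
  forall i, (i < n)%N -> a i = b i.
Proof.
elim: n a b => // n IH a b aB bB.
rewrite !big_ord_recl /= !expn0 !muln1.
have shift (c : nat -> nat) : (\sum_(i < n) c (bump 0 i) * B ^ bump 0 i =
    (\sum_(i < n) c i.+1 * B ^ i) * B)%N.
  by rewrite big_distrl; apply: eq_bigr => i _; rewrite /bump leq0n add1n expnSr mulnA.
rewrite !shift => E.
have E0 : a 0%N = b 0%N.
  have := congr1 (modn^~ B) E; rewrite /= !(addnC (_ 0%N)) !modnMDl.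
  by rewrite !modn_small ?aB ?bB.
have B0 : (0 < B)%N by apply: leq_ltn_trans (aB 0%N isT).
move: E; rewrite E0 => /addnI/eqP; rewrite eqn_pmul2r// => /eqP E.
move=> [//|i] iN; apply: (IH (a \o S) (b \o S)) E i iN.
- by move=> j jn; apply: aB.
- by move=> j jn; apply: bB.
Qed.

(* Kronecker's substitution [x_i = t ^ (d.+1 ^ i)] separates the monomials. *)
Lemma feval_neq0 n d (f : pform R n d) : f != 0 ->
  exists2 x, size x = n & feval f x != 0.
Proof.
move=> f0; have [a0 fa0] : exists a, f a != 0.
  apply/existsP; apply: contraNT f0; rewrite negb_exists => /forallP h.
  by apply/eqP/ffunP => a; rewrite ffunE; apply/eqP; have := h a; rewrite negbK.
pose e (a : mon n d) := (\sum_(i < n) tnth (val a) i * d.+1 ^ i)%N.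
have e_inj : injective e.
  move=> a b; rewrite /e => eab; apply/val_inj/eq_from_tnth => i; apply/val_inj => /=.
  pose c (u : mon n d) j := nth 0%N [seq nat_of_ord k | k <- val u] j.
  have cE u (j : 'I_n) : c u j = tnth (val u) j.
    by rewrite /c (nth_map ord0) ?size_tuple// -tnth_nth.
  have cB u j : (j < n)%N -> (c u j < d.+1)%N by move=> jn; rewrite (cE u (Ordinal jn)).
  rewrite -!cE; apply: (@digits_inj d.+1 n) => //; [exact: cB|exact: cB|].
  by under eq_bigr do rewrite cE; under [RHS]eq_bigr do rewrite cE.
pose p : {poly R} := \sum_a f a *: 'X^(e a).
have p0 : p != 0.
  apply/eqP => /(congr1 (fun q : {poly R} => q`_(e a0))); rewrite coef0 coef_sum.
  rewrite (bigD1 a0)//= coefZ coefXn eqxx mulr1 big1 => [|a aa0].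
    by rewrite addr0; apply/eqP.
  by rewrite coefZ coefXn (inj_eq e_inj) eq_sym (negbTE aa0) mulr0.
have [t pt] : exists t, ~~ root p t.
  (* A nonzero polynomial has fewer than [size p] roots, so one of the first [size p] natural
     numbers is not a root. *)
  pose rs : seq R := [seq i%:R | i <- iota 0 (size p)].
  have : ~~ all (root p) rs.
    apply/negP => h; have := max_poly_roots p0 h.
    rewrite size_map size_iota ltnn map_inj_uniq ?iota_uniq; first by move/(_ isT).
    by move=> i j /eqP; rewrite eqr_nat => /eqP.
  by case/allPn => t _ ?; exists t.
exists [seq t ^+ (d.+1 ^ i) | i <- iota 0 n]; first by rewrite size_map size_iota.
move: pt; rewrite /root /p horner_sum /feval; apply: contra => /eqP E.
rewrite -[X in _ == X]E; apply/eqP; apply: eq_bigr => a _; rewrite hornerZ hornerXn; congr (_ * _).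
rewrite /e -prodrXr; apply: eq_bigr => i _.
by rewrite (nth_map 0%N) ?size_iota// nth_iota// add0n -exprM mulnC.
Qed.

(** A point where [f] does not vanish is rescaled to norm 1/2, so that a cube around it stays in the
    unit ball. There |f| is at least half its value at the centre, and passing from s to [radial s]
    can only increase |f|, by homogeneity and |s| <= 1. *)
Lemma sip_gt0 n d (f : pform R n d) : (0 < d)%N -> f != 0 -> 0 < sip f f.
Proof.
move=> d0 /feval_neq0[x xn fx].
have x0 : sqn x != 0 by apply: contra fx => /eqP /feval_sqn0 ->.
pose y := [seq 2^-1 * t | t <- radial x].
have yn : size y = n by rewrite size_map size_radial.
have y_nth i : nth 0 y i = 2^-1 * nth 0 (radial x) i.
  have [ix|xi] := ltnP i (size (radial x)); first by rewrite (nth_map 0).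
  by rewrite !nth_default ?mulr0// size_map.
have fy : feval f y != 0.
  rewrite (feval_homo f y_nth) mulf_neq0 ?expf_neq0 ?invr_eq0//.
  by move: fx; rewrite feval_radial// mulf_eq0 => /norP[].
have sy : sqn y = 4^-1.
  have := sqn_radial x0; rewrite !(sqn_sum (etrans (size_radial x) xn)) (sqn_sum yn) => E.
  under eq_bigr do rewrite y_nth exprMn.
  by rewrite -mulr_sumr E; field.
pose eta := `|feval f y| / 2.
have eta0 : 0 < eta by rewrite divr_gt0// normr_gt0.
(* Since |y|^2 = 1/4, a variation of at most 1/2 keeps |s|^2 below 1. *)
have h2 : (0 : R) < 2^-1 by rewrite invr_gt0.
have [e1 e10 near1] := loclip_near (loclip_feval f y) eta0.
have [e2 e20 near2] := loclip_near (loclip_sqn y) h2.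
have e0 : 0 < Num.min e1 e2 by rewrite lt_min e10.
have eta20 : 0 < eta ^+ 2 by rewrite exprn_gt0.
apply: (sphere_int_gt0 (sbounded_feval2 f f) _ e0 eta20 yn).
  by move=> z _; rewrite -expr2 sqr_ge0.
move=> s sn bs.
have h1 : `|feval f s - feval f y| <= eta.
  by apply: near1 bs; rewrite ?sn ?yn// ltW//= ge_min lexx.
have {}h2 : `|sqn s - sqn y| <= 2^-1.
  by apply: near2 bs; rewrite ?sn ?yn// ltW//= ge_min lexx orbT.
have s1 : sqn s <= 1.
  by move: h2; rewrite sy ler_norml => /andP[_ h]; lra.
split=> //.
have fs : eta <= `|feval f s|.
  have := ler_normB (feval f s) (feval f s - feval f y).
  rewrite opprB addrC subrK => h; rewrite /eta in h1 *; lra.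
have s0 : sqn s != 0.
  by apply: contraTN fs => /eqP /feval_sqn0 ->//; rewrite normr0 -ltNge.
rewrite -expr2 -[leRHS]real_normK ?num_real//.
rewrite ler_pXn2r ?nnegrE ?normr_ge0 ?(ltW eta0)//; apply: (le_trans fs).
rewrite feval_radial// normrM ler_piMl// normrX exprn_ile1//.
by rewrite ger0_norm ?sqrtr_ge0// -sqrtr1 ler_wsqrtr.
Qed.

End PositiveDefinite.

(** * Products of forms and their composition with linear maps *)

Section FormComposition.
Variables (R : realType) (n : nat).
Implicit Types (F G : seq R -> R).

(** Reasoning on functions avoids writing out the coefficients of a form composed with a matrix. *)
Definition isform d F := exists f : pform R n d,
  forall x, size x = n -> F x = feval f x.

Lemma isform_ext d F G : (forall x, size x = n -> F x = G x) -> isform d F -> isform d G.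
Proof. by move=> FG [f hf]; exists f => x xn; rewrite -FG// hf. Qed.

Lemma isformD d F G : isform d F -> isform d G -> isform d (fun x => F x + G x).
Proof.
by move=> [f hf] [g hg]; exists (f + g) => x xn; rewrite fevalD hf ?hg.
Qed.

Lemma isformZ d k F : isform d F -> isform d (fun x => k * F x).
Proof. by move=> [f hf]; exists (k *: f) => x xn; rewrite fevalZ hf. Qed.

Lemma isform_sum d I (r : seq I) (F : I -> seq R -> R) :
  (forall i, isform d (F i)) -> isform d (fun x => \sum_(i <- r) F i x).
Proof.
move=> hF; elim: r => [|i r IH].
  by exists 0 => x xn; rewrite big_nil feval0.
apply: isform_ext (isformD (hF i) IH) => x xn.
by rewrite big_cons.
Qed.

Lemma isform_mon (e : 'I_n -> nat) :
  isform (\sum_i e i) (fun x => \prod_(i < n) nth 0 x i ^+ e i).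
Proof.
pose d := (\sum_i e i)%N.
have ed i : (e i < d.+1)%N by rewrite ltnS /d (bigD1 i)//= leq_addr.
pose t := [tuple (inord (e i) : 'I_d.+1) | i < n].
have tE i : tnth t i = e i :> nat by rewrite tnth_mktuple inordK.
have tP : (\sum_(i <- t) (i : nat))%N == d.
  by rewrite big_tuple /d; apply/eqP/eq_bigr => i _; rewrite tE.
pose a : mon n d := exist _ t tP.
exists [ffun b => (b == a)%:R] => x xn.
rewrite /feval (bigD1 a)//= ffunE eqxx mul1r [X in _ + X]big1 ?addr0 => [|b ba].
  by apply: eq_bigr => i _; rewrite tE.
by rewrite ffunE (negbTE ba) mul0r.
Qed.

Lemma isformM d d' F G : isform d F -> isform d' G -> isform (d + d') (fun x => F x * G x).
Proof.
move=> [f hf] [g hg].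
apply: (@isform_ext _ (fun x => \sum_(a : mon n d) \sum_(b : mon n d')
  f a * g b * \prod_(i < n) nth 0 x i ^+ (tnth (val a) i + tnth (val b) i))).
  move=> x xn; rewrite hf// hg// /feval mulr_suml; apply: eq_bigr => a _.
  rewrite mulr_sumr; apply: eq_bigr => b _.
  rewrite mulrACA; congr (_ * _); rewrite -big_split.
  by apply: eq_bigr => i _; rewrite exprD.
apply: isform_sum => a; apply: isform_sum => b; apply: isformZ.
have := isform_mon (fun i => tnth (val a) i + tnth (val b) i)%N.
by rewrite big_split /= !sum_mon.
Qed.

Lemma isform1 : isform 0 (fun=> 1).
Proof.
have := isform_mon (fun=> 0%N); rewrite big1//.
by apply: isform_ext => x xn; rewrite big1.
Qed.

Lemma isformX d F k : isform d F -> isform (d * k) (fun x => F x ^+ k).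
Proof.
move=> hF; elim: k => [|k IH]; first by rewrite muln0; exact: isform1.
rewrite mulnS; apply: isform_ext (isformM hF IH) => x _.
by rewrite exprS.
Qed.

Lemma isform_prod I (r : seq I) (e : I -> nat) (F : I -> seq R -> R) :
  (forall i, isform (e i) (F i)) ->
  isform (\sum_(i <- r) e i) (fun x => \prod_(i <- r) F i x).
Proof.
move=> hF; elim: r => [|i r IH].
  by rewrite big_nil; apply: isform_ext isform1 => x _; rewrite big_nil.
rewrite big_cons; apply: isform_ext (isformM (hF i) IH) => x _.
by rewrite big_cons.
Qed.

Lemma isform_nth (i : 'I_n) : isform 1 (fun x => nth 0 x i).
Proof.
have := isform_mon (fun j => (j == i) : nat).
rewrite (bigD1 i)//= eqxx big1 ?addn0 => [|j ji]; last by rewrite (negbTE ji).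
apply: isform_ext => x _; rewrite (bigD1 i)//= eqxx expr1 big1 ?mulr1// => j ji.
by rewrite (negbTE ji) expr0.
Qed.

Lemma isform_comp d (f : pform R n d) (U : 'M[R]_n) :
  isform d (fun x => feval f (lst (vec n x *m U))).
Proof.
apply: isform_sum => a; apply: isformZ; rewrite -[d in isform d](sum_mon a).
apply: (isform_prod (index_enum 'I_n)
  (F := fun i x => nth 0 (lst (vec n x *m U)) i ^+ tnth (val a) i)) => i.
rewrite -[X in isform X]mul1n; apply: isformX.
apply: (@isform_ext _ (fun x => \sum_j U j i * nth 0 x j)).
  by move=> x xn; rewrite nth_lst mxE; apply: eq_bigr => j _; rewrite mxE mulrC.
by apply: isform_sum => j; apply: isformZ; exact: isform_nth.
Qed.

End FormComposition.

Lemma card_mon n d : #|{: mon n.+1 d}| = 'C(n + d, n).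
Proof.
rewrite -card_ord_partitions card_sig; apply: eq_card => t.
by rewrite !inE.
Qed.

(** * Cholesky factorization and a determinant bound *)

Section Cholesky.
Variable R : rcfType.

Definition posdef m (G : 'M[R]_m) :=
  G^T = G /\ forall u : 'rV_m, u != 0 -> 0 < (u *m G *m u^T) 0 0.

(** Induction on the Schur complement of the corner entry: its triangular factor is bordered by the
    square root of the corner. *)
Lemma cholesky m (G : 'M[R]_m) : posdef G ->
  exists T : 'M[R]_m, [/\ is_trig_mx T, T \in unitmx & G = T *m T^T].
Proof.
elim: m G => [|m IH] G [Gs Gp].
  exists 0; split; [by apply/is_trig_mxP => -[] | by rewrite unitmxE det_mx00 unitr1|].
  by rewrite [LHS]flatmx0 [RHS]flatmx0.
move: G Gs Gp; rewrite -[m.+1]/(1 + m)%N => G; rewrite -[G]submxK.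
set a := ulsubmx _; set b := ursubmx _; set c := dlsubmx _; set C := drsubmx _.
rewrite tr_block_mx => /eq_block_mx[_ cb bc CC] Gp.
have cE : c = b^T by rewrite bc.
pose r := a 0 0; have aE : a = r%:M by exact: mx11_scalar.
have r0 : 0 < r.
  have /Gp : row_mx 1%:M 0 != 0 :> 'rV[R]_(1 + m).
    apply/eqP => /(congr1 lsubmx); rewrite row_mxKl linear0.
    by move=> /(congr1 (fun M : 'M[R]_1 => M 0 0)) /eqP; rewrite !mxE/= oner_eq0.
  rewrite mul_row_block !mul1mx !mul0mx !addr0 tr_row_mx mul_row_col trmx1 mulmx1.
  by rewrite trmx0 mulmx0 addr0.
have rN0 : r != 0 by rewrite gt_eqF.
pose S := C - r^-1 *: (b^T *m b).
have [|T [Tt Tu ST]] := IH S.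
  split; first by rewrite /S linearB /= linearZ /= trmx_mul trmxK CC.
  (* [al] is the first coordinate that minimizes the quadratic form of [G] for given [w]; the
     minimum is the form of [S] at [w]. *)
  move=> w w0; pose al := - r^-1 *: (w *m b^T).
  have /Gp : row_mx al w != 0 :> 'rV[R]_(1 + m).
    by apply: contraNneq w0 => /(congr1 rsubmx); rewrite row_mxKr linear0 => ->.
  rewrite mul_row_block cE aE mul_mx_scalar /al scalerA mulrN mulfV// scaleN1r addNr.
  rewrite tr_row_mx mul_row_col mul0mx add0r.
  suff -> : (- r^-1 *: (w *m b^T)) *m b + w *m C = w *m S by [].
  by rewrite /S mulmxBr -scalemxAr -scalemxAl mulmxA scaleNr addrC.
pose q := Num.sqrt r; have q0 : q != 0 by rewrite sqrtr_eq0 -ltNge.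
have qq : q * q = r by rewrite -expr2 sqr_sqrtr// ltW.
exists (block_mx q%:M 0 (q^-1 *: b^T) T); split.
- apply/is_trig_mxP => i j; rewrite mxE.
  case: (splitP (i : 'I_(1 + m))) => i' ->; rewrite mxE; case: (splitP (j : 'I_(1 + m))) => j' ->.
  + by rewrite !ord1.
  + by rewrite mxE.
  + by rewrite ord1 ltn0.
  + by rewrite ltn_add2l; move/is_trig_mxP: Tt; apply.
- by rewrite unitmxE det_lblock unitrM det_scalar1 unitfE q0 -unitmxE.
rewrite tr_block_mx mulmx_block !trmx0 !mulmx0 !mul0mx !addr0 -ST aE cE.
rewrite tr_scalar_mx linearZ /= trmxK -scalar_mxM qq; congr block_mx.
- by rewrite -scalemxAr mul_scalar_mx scalerA mulVf// scale1r.
- by rewrite mul_mx_scalar scalerA mulfV// scale1r.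
- rewrite -scalemxAl -scalemxAr scalerA -invfM qq /S.
  by rewrite addrC subrK.
Qed.

Lemma sqr_mulmx_ge0 m (v : 'rV[R]_m) : 0 <= (v *m v^T) 0 0.
Proof. by rewrite mxE sumr_ge0// => i _; rewrite mxE -expr2 sqr_ge0. Qed.

Lemma sqr_mulmx_eq0 m (v : 'rV[R]_m) : ((v *m v^T) 0 0 == 0) = (v == 0).
Proof.
rewrite mxE psumr_eq0 => [|i _]; last by rewrite mxE -expr2 sqr_ge0.
apply/allP/eqP => [h|-> i _]; last by rewrite !mxE mul0r eqxx.
apply/rowP => i; have := h i (mem_index_enum _); rewrite !mxE -expr2 sqrf_eq0.
by move/eqP.
Qed.

Lemma posdef_gram m (A : 'M[R]_m) : A \in unitmx -> posdef (A *m A^T).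
Proof.
move=> Au; split; first by rewrite trmx_mul trmxK.
move=> u u0; rewrite mulmxA -mulmxA -trmx_mul lt_neqAle sqr_mulmx_ge0 andbT eq_sym.
by rewrite sqr_mulmx_eq0; apply: contra u0 => /eqP/(canRL (mulmxK Au)) ->; rewrite mul0mx.
Qed.

Lemma mxtrace_gram m (A : 'M[R]_m) : \tr (A *m A^T) = \sum_i \sum_j A i j ^+ 2.
Proof.
by apply: eq_bigr => i _; rewrite mxE; apply: eq_bigr => j _; rewrite mxE expr2.
Qed.

(** The triangular factor [T] of A A^T dispenses with eigenvalues: the trace is the sum of the
    squares of all entries of [T], while the determinant sees only the diagonal. In the equality
    case the off-diagonal entries have no share of the trace left, and the arithmetic-geometric
    inequality makes the squared diagonal entries equal. *)
Lemma det_frobenius m (A : 'M[R]_m) : (0 < m)%N -> A \in unitmx ->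
  \sum_i \sum_j A i j ^+ 2 <= 1 ->
  \det A ^+ 2 <= m%:R^-1 ^+ m /\
  (\det A ^+ 2 = m%:R^-1 ^+ m ->
   \sum_i \sum_j A i j ^+ 2 = 1 /\ A *m A^T = m%:R^-1%:M).
Proof.
case: m A => // m A _ Au; rewrite -mxtrace_gram; set G := A *m A^T.
have <- : \det G = \det A ^+ 2 by rewrite det_mulmx det_tr expr2.
have [T [Tt Tu GT]] := cholesky (posdef_gram Au).
rewrite /G GT.
rewrite mxtrace_gram det_mulmx det_tr.
set N := m.+1; pose P := \prod_i T i i ^+ 2.
have -> : \det T * \det T = P by rewrite -expr2 (det_trig Tt) /P prodrXl.
pose D := \sum_i T i i ^+ 2.
pose O := \sum_i \sum_(j | j != i) T i j ^+ 2.
have -> : \sum_i \sum_j T i j ^+ 2 = D + O.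
  by rewrite /D /O -big_split; apply: eq_bigr => i _; rewrite (bigD1 i).
have O0 : 0 <= O by apply: sumr_ge0 => i _; apply: sumr_ge0 => j _; exact: sqr_ge0.
have D0 : 0 <= D by apply: sumr_ge0 => i _; exact: sqr_ge0.
move=> DO.
have N0 : 0 < N%:R :> R by rewrite ltr0n.
have [PD PDeq] := @leif_AGM R 'I_N predT (fun i => T i i ^+ 2) (fun i _ => sqr_ge0 _).
rewrite /= card_ord in PD PDeq.
have PD' : P <= (D / N%:R) ^+ N by exact: PD.
have DN : D / N%:R <= N%:R^-1 by rewrite ler_pdivrMr// mulVf ?gt_eqF//; lra.
have DN0 : 0 <= D / N%:R by rewrite divr_ge0// ltW.
have DNX : (D / N%:R) ^+ N <= N%:R^-1 ^+ N.
  by rewrite lerXn2r// nnegrE ltW// invr_gt0.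
split; first exact: le_trans PD' DNX.
move=> PN.
(* Equality collapses the chain P <= (D/N)^N <= N^(-N). Hence D = 1, and D + O <= 1 leaves O = 0. *)
have E1 : (D / N%:R) ^+ N = N%:R^-1 ^+ N.
  by apply/eqP; rewrite eq_le DNX -PN PD'.
have D1 : D = 1.
  have /eqP := E1; rewrite eqrXn2// ?invr_ge0 ?ltW// => /eqP E.
  by have := congr1 ( *%R^~ N%:R) E; rewrite /= divfK ?mulVf// gt_eqF.
have O1 : O = 0 by apply/eqP; rewrite eq_le O0 andbT; lra.
split; first by rewrite D1 O1 addr0.
have Teq i : T i i ^+ 2 = N%:R^-1.
  have : P == (D / N%:R) ^+ N by rewrite E1 PN.
  rewrite /P /D PDeq => /forallP /(_ i) /= /forallP h.
  have : D = N%:R * T i i ^+ 2.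
    rewrite /D (eq_bigr (fun=> T i i ^+ 2)) => [|j _].
      by rewrite sumr_const card_ord mulr_natl.
    by have /= /eqP -> := h j.
  rewrite D1 => E; apply: (mulfI (lt0r_neq0 N0)); rewrite -E mulfV//.
  by rewrite gt_eqF.
have Toff i j : j != i -> T i j = 0.
  move=> ij; apply/eqP; rewrite -sqrf_eq0.
  move/eqP: O1; rewrite psumr_eq0 => [/allP/(_ i (mem_index_enum _))/=|k _]; last first.
    by apply: sumr_ge0 => l _; exact: sqr_ge0.
  rewrite psumr_eq0 => [/allP/(_ j (mem_index_enum _))/=|k _]; last exact: sqr_ge0.
  by rewrite ij.
apply/matrixP => i j; rewrite !mxE (bigD1 i)//= big1 ?addr0 => [|k ki]; last first.
  by rewrite Toff ?mul0r.
rewrite mxE; have [->|ij] := eqVneq i j; first by rewrite -expr2 Teq mulr1n.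
by rewrite (Toff j i)// mulr0 mulr0n.
Qed.

End Cholesky.

(** * An orthonormal basis of the mean-zero forms *)

Section Basis.
Variables (R : realType) (n k : nat).
Local Notation d := k.*2.
Local Notation form := (pform R n d).

Lemma eq_sphere_int_size (F G : seq R -> R) : (forall x, size x = n -> F x = G x) ->
  sphere_int n F = sphere_int n G.
Proof.
move=> FG; congr (fine _ / _); apply: eq_iint => x xn.
by rewrite FG// size_radial.
Qed.

Definition mono (a : mon n d) : form := [ffun b => (b == a)%:R].

Lemma feval_mono a x : feval (mono a) x = \prod_(i < n) nth 0 x i ^+ tnth (val a) i.
Proof.
rewrite /feval (bigD1 a)//= ffunE eqxx mul1r [X in _ + X]big1 ?addr0// => b ba.
by rewrite ffunE (negbTE ba) mul0r.
Qed.

Lemma mono_sum (f : form) : f = \sum_a f a *: mono a.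
Proof.
apply/ffunP => b; rewrite sum_ffunE (bigD1 b)//= !ffunE eqxx.
rewrite big1 => [|a ab]; first by rewrite addr0 [RHS]mulr1.
by rewrite !ffunE eq_sym (negbTE ab) [LHS]mulr0.
Qed.

Hypothesis n_gt0 : (0 < n)%N.
Hypothesis k_gt0 : (0 < k)%N.

Lemma alpha0P : \sum_(i <- alpha0 n d) (i : nat) == d.
Proof.
rewrite big_tuple (bigD1 (Ordinal n_gt0))//= tnth_mktuple/= inordK//.
by rewrite big1 => [|i i0]; [rewrite addr0|rewrite tnth_mktuple ifN].
Qed.

Definition mon0 : mon n d := exist _ (alpha0 n d) alpha0P.

(** The even power x_0^(2k) is the square of the form x_0^k, so its mean is a squared norm. *)
Lemma sint_mono0_gt0 : 0 < sint (mono mon0).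
Proof.
have [f hf] := isform_mon R (fun i : 'I_n => if (i : nat) == 0%N then k else 0%N).
move: f hf; rewrite (bigD1 (Ordinal n_gt0))//= big1 ?addn0 => [f hf|i i0]; last first.
  by rewrite ifN.
have f0 : f != 0.
  apply: contraTneq isT => f0; have := hf (nseq n 1) (size_nseq n 1).
  rewrite f0 feval0 big1 => [/eqP|i _]; first by rewrite oner_eq0.
  by rewrite nth_nseq ltn_ord expr1n.
have := sip_gt0 k_gt0 f0; congr (_ < _); apply: eq_sphere_int_size => x xn.
rewrite feval_mono -hf// -big_split /=; apply: eq_bigr => i _.
rewrite tnth_mktuple -exprD addnn; congr (_ ^+ _).
by case: ifP => // _; rewrite inordK.
Qed.

Local Notation m := (#|{: mon n d}|).-1.

(** The enumeration used by [proj], so that the entries of [proj f] are the coefficients of [f] at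
    the [monx i]. *)
Definition mons := [seq a <- enum (@predT (mon n d)) | val a != alpha0 n d].

Lemma mem_mons a : (a \in mons) = (a != mon0).
Proof. by rewrite mem_filter mem_enum andbT -val_eqE. Qed.

Lemma size_mons : size mons = m.
Proof.
rewrite -(cardC1 mon0) cardE; apply: perm_size; apply: uniq_perm.
- by rewrite filter_uniq// enum_uniq.
- exact: enum_uniq.
- by move=> a; rewrite mem_mons mem_enum.
Qed.

Definition monx (i : 'I_m) := nth mon0 mons i.

Lemma monx_inj : injective monx.
Proof.
have mu : uniq mons by rewrite filter_uniq// enum_uniq.
by move=> i j /eqP; rewrite nth_uniq ?size_mons// => /eqP/val_inj.
Qed.

Lemma monx_neq0 i : monx i != mon0.
Proof. by rewrite -mem_mons mem_nth// size_mons. Qed.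

Lemma monxP a : a != mon0 -> exists i, monx i = a.
Proof.
rewrite -mem_mons => am; have := am; rewrite -index_mem size_mons => im.
by exists (Ordinal im); rewrite /monx nth_index.
Qed.

Lemma proj_lst (f : form) : Defs.proj f = lst (\row_i f (monx i)).
Proof.
apply: (@eq_from_nth _ 0) => [|i]; first by rewrite size_lst size_map size_mons.
rewrite size_map size_mons => im; rewrite (nth_lst _ (Ordinal im)) mxE.
by rewrite (nth_map mon0) ?size_mons.
Qed.

(** A multiple of x_0^(2k) brings each other monomial to mean zero. This changes only the
    coefficient that [proj] forgets, so [proj] reads off coordinates in this basis. *)
Definition hbase i : form :=
  mono (monx i) - (sint (mono (monx i)) / sint (mono mon0)) *: mono mon0.

Lemma hbase_monx i j : hbase i (monx j) = (i == j)%:R.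
Proof.
rewrite !ffunE (inj_eq monx_inj) (negbTE (monx_neq0 j)) eq_sym.
by rewrite [X in _ - X]mulr0 subr0.
Qed.

Lemma sint_hbase i : sint (hbase i) = 0.
Proof. by rewrite sintB sintZ divfK ?subrr// gt_eqF// sint_mono0_gt0. Qed.

Definition hcomb (t : 'rV[R]_m) : form := \sum_i t 0 i *: hbase i.

Lemma hcomb_monx t j : hcomb t (monx j) = t 0 j.
Proof.
rewrite sum_ffunE (bigD1 j)//= big1 => [|i ij].
  by rewrite addr0 ffunE hbase_monx eqxx [LHS]mulr1.
by rewrite ffunE hbase_monx (negbTE ij) [LHS]mulr0.
Qed.

Lemma hcombK (f : form) : sint f = 0 -> f = hcomb (\row_i f (monx i)).
Proof.
move=> f0; set g := hcomb _; apply/eqP; rewrite -subr_eq0.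
(* [f] and [g] agree in all coefficients but that of [mon0]. Their difference is thus a multiple of
   a form of positive mean, and its own mean is zero. *)
have E : f - g = (f - g) mon0 *: mono mon0.
  rewrite {1}(mono_sum (f - g)) (bigD1 mon0)//= big1 ?addr0// => a /monxP[i <-].
  by rewrite !ffunE hcomb_monx mxE subrr scale0r.
have : sint (f - g) = 0.
  rewrite sintB f0 sub0r sint_sum big1 ?oppr0// => i _.
  by rewrite sintZ sint_hbase mulr0.
rewrite E sintZ => /eqP; rewrite mulf_eq0 (gt_eqF sint_mono0_gt0) orbF => /eqP ->.
by rewrite scale0r.
Qed.

Definition hgram := \matrix_(i, j) sip (hbase i) (hbase j).

Lemma sip_hcomb t u : sip (hcomb t) (hcomb u) = (t *m hgram *m u^T) 0 0.
Proof.
rewrite sip_sumr mxE; apply: eq_bigr => j _.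
rewrite sipZr mulrC !mxE sip_suml; congr (_ * _); apply: eq_bigr => i _.
by rewrite sipZl mxE.
Qed.

Lemma posdef_hgram : posdef hgram.
Proof.
split; first by apply/matrixP => i j; rewrite !mxE sipC.
move=> t t0; rewrite -sip_hcomb sip_gt0 ?double_gt0//.
apply: contra t0 => /eqP t0; apply/eqP/rowP => i.
by rewrite -hcomb_monx t0 ffunE mxE.
Qed.

(** If the Gram matrix of [hbase] is T T^T, the rows of T^(-1) are the coordinates of an orthonormal
    basis. The last clause, with P = T^(-1), relates orthonormal coordinates to those in which
    [volM] measures volume. *)
Lemma orthonormal_basis : exists (P : 'M[R]_m) (psi : 'I_m -> form),
  [/\ P \in unitmx, forall i, sint (psi i) = 0,
      forall i j, sip (psi i) (psi j) = (i == j)%:R,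
      forall f, sint f = 0 -> exists u : 'rV[R]_m, f = \sum_i u 0 i *: psi i &
      forall (f : form) (u : 'rV[R]_m),
        Defs.proj (f + \sum_i u 0 i *: psi i) = lst (vec m (Defs.proj f) + u *m P)].
Proof.
have [T [_ Tu TE]] := cholesky posdef_hgram.
pose psi i := hcomb (row i (invmx T)).
have psiE (u : 'rV[R]_m) : \sum_i u 0 i *: psi i = hcomb (u *m invmx T).
  rewrite /hcomb; under eq_bigr do rewrite /psi /hcomb scaler_sumr.
  rewrite exchange_big; apply: eq_bigr => j _.
  by rewrite mxE scaler_suml; apply: eq_bigr => i _; rewrite scalerA mxE.
exists (invmx T), psi; split.
- by rewrite unitmx_inv.
- by move=> i; rewrite sint_sum big1// => j _; rewrite sintZ sint_hbase mulr0.
- move=> i j; rewrite sip_hcomb TE !rowE trmx_mul !mulmxA.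
  rewrite -(mulmxA _ (invmx T) T) mulVmx// mulmx1.
  rewrite -(mulmxA _ T^T) -trmx_mul mulVmx// trmx1 mulmx1 trmx_delta mul_delta_mx_cond.
  by case: eqVneq => _; rewrite ?mulr1n ?mulr0n !mxE ?eqxx.
- move=> f f0; exists ((\row_i f (monx i)) *m T).
  by rewrite psiE mulmxK//; exact: hcombK.
- move=> f u; rewrite psiE proj_lst; congr lst; apply/rowP => i.
  by rewrite [in LHS]mxE ffunE hcomb_monx [in RHS]mxE proj_lst lstK [in RHS]mxE.
Qed.

End Basis.

(** * Volumes of affine images of the ball; reflections *)

Section AffineVolume.
Variable R : realType.

(** The indicator of the image is that of the ball composed with the inverse affine map; the
    translation costs nothing and the linear part contributes |det A|. *)
Lemma lebm_affine_ball m (A : 'M[R]_m) (b : 'rV[R]_m) : A \in unitmx ->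
  lebm m [set lst (b + u *m A) | u in [set u : 'rV[R]_m | (u *m u^T) 0 0 <= 1]] =
  (`|\det A| * ball_vol R m)%:E.
Proof.
move=> Au; pose g s := (ballf m (lst (vec m s *m invmx A)))%:E.
have mg : meas1 m g.
  apply/rmeas_EFin/rmeas_lst; first exact: rmeas_ballf.
  by move=> i; apply: jmeas_mulmx => j; exact: jmeas_vec.
have g0 s : (0 <= g s)%E by rewrite lee_fin ler0n.
transitivity (iint m (fun s => g (lst (vec m s + - b)))).
  apply: eq_iint => s sm; rewrite /g indicE lstK /ballf size_lst eqxx /= sqn_lst.
  congr (nat_of_bool _)%:R%:E; apply/idP/idP.
    move=> /set_mem[u /= u1 <-]; rewrite lstK addrAC subrr add0r mulmxK//.
  move=> h; apply/mem_set; exists ((vec m s - b) *m invmx A) => //=.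
  by rewrite mulmxKV// addrC subrK vecK.
have Aiu : invmx A \in unitmx by rewrite unitmx_inv.
rewrite iint_translate//.
rewrite [LHS](linear_change_unitmx Aiu (g := fun s => (ballf m s)%:E)).
- by rewrite -lebm_ball ball_volE -EFinM det_inv normfV invrK.
- by move=> s; rewrite lee_fin ler0n.
- by apply/rmeas_EFin; exact: rmeas_ballf.
Qed.

(* The witness is the Householder reflection exchanging [v] and [w]. *)
Lemma orthogonal_transitive n (v w : seq R) : size v = n -> size w = n ->
  sqn v = 1 -> sqn w = 1 ->
  exists U : 'M[R]_n, U *m U^T = 1%:M /\ lst (vec n v *m U) = w.
Proof.
move=> vn wn v1 w1; have [<-|vw] := eqVneq v w.
  by exists 1%:M; rewrite trmx1 !mulmx1 vecK.
pose x := vec n v; pose y := vec n w; pose z := x - y; pose zz := (z *m z^T) 0 0.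
have zz0 : zz != 0.
  rewrite sqr_mulmx_eq0 subr_eq0; apply: contra vw => /eqP xy.
  by rewrite -(vecK vn) -(vecK wn) -/x xy.
have zzE : z *m z^T = zz%:M by exact: mx11_scalar.
pose c := (x *m y^T) 0 0.
have yxE : (y *m x^T) 0 0 = c.
  by rewrite /c !mxE; apply: eq_bigr => j _; rewrite !mxE mulrC.
have xz : x *m z^T = (1 - c)%:M.
  rewrite linearB mulmxBr [LHS]mx11_scalar mxE -(sqn_vec vn) v1.
  by congr (_%:M); rewrite mxE.
have yz : y *m z^T = (c - 1)%:M.
  rewrite linearB mulmxBr [LHS]mx11_scalar mxE yxE.
  by congr (_%:M); rewrite mxE -(sqn_vec wn) w1.
have zzc : zz = 2 * (1 - c).
  by rewrite /zz {1}/z mulmxBl xz yz !mxE /= !mulr1n; ring.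
have c1 : 1 - c != 0 by apply: contra zz0 => /eqP c0; rewrite zzc c0 mulr0.
(* [W] is twice the orthogonal projection onto [z], hence W W = 2 W, and U = 1 - W is a symmetric
   involution. *)
pose W := (2 / zz) *: (z^T *m z); pose U := 1%:M - W.
have WW : W *m W = W + W.
  rewrite /W -scalemxAl -scalemxAr scalerA -mulmxA (mulmxA z) zzE mul_scalar_mx.
  by rewrite -scalemxAr scalerA -scalerDl; congr (_ *: _); field.
have UT : U^T = U.
  by rewrite /U /W linearB /= trmx1 linearZ /= trmx_mul trmxK.
exists U; split.
  rewrite UT /U mulmxBl mul1mx mulmxBr mulmx1 WW.
  by rewrite (_ : W - (W + W) = - W) ?opprK ?subrK// opprD addrA subrr add0r.
rewrite -[RHS](vecK wn); congr lst.
rewrite -/x /U /W mulmxBr mulmx1 -scalemxAr mulmxA xz mul_scalar_mx scalerA.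
rewrite (_ : 2 / zz * (1 - c) = 1); last by rewrite zzc; field.
by rewrite scale1r /z opprB addrC subrK.
Qed.

End AffineVolume.

(** * The Loewner ellipsoid *)

Section Loewner.
Variables (R : realType) (n k : nat).
Local Notation d := k.*2.
Local Notation form := (pform R n d).
Hypothesis n_gt0 : (0 < n)%N.
Hypothesis k_gt0 : (0 < k)%N.
Variable r : form.
Hypothesis rE : forall x, size x = n -> feval r x = sqn x ^+ k.
Implicit Types (f g : form) (v x : seq R).

Lemma feval_r x : size x = n -> sqn x = 1 -> feval r x = 1.
Proof. by move=> xn x1; rewrite rE// x1 expr1n. Qed.

Lemma sip_r f : sip r f = sint f.
Proof.
apply: (eq_sphere_int n_gt0 (sbounded_feval2 r f) (sbounded_feval f)) => x xn x1.
by rewrite feval_r// mul1r.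
Qed.

Lemma sint_r : sint r = 1.
Proof.
rewrite -[RHS](@sphere_int_cst R n).
apply: (eq_sphere_int n_gt0 (sbounded_feval r) (sbounded_cst n ler01)) => x xn x1.
exact: feval_r.
Qed.

Lemma sum_sip_le1 (I : finType) (phi : I -> form) :
  (forall v, size v = n -> sqn v = 1 -> \sum_i feval (phi i) v ^+ 2 <= 1) ->
  \sum_i sip (phi i) (phi i) <= 1.
Proof.
(* The bound 1 is integrated as the square of [r], which vanishes like every form at the junk value
   [radial 0 = 0]; the pointwise inequality then holds there too. *)
move=> h; rewrite -subr_ge0 -sint_r -sip_r -sumrN.
pose F i x := - 1 * (feval (phi i) x * feval (phi i) x).
have Fb i := sboundedZ (- 1) (sbounded_feval2 (phi i) (phi i)).
have -> : \sum_i - sip (phi i) (phi i) = sphere_int n (fun x => \sum_i F i x).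
  rewrite (sphere_int_sum (index_enum I) Fb).
  apply: eq_bigr => i _.
  by rewrite (sphere_intZ (- 1) (sbounded_feval2 (phi i) (phi i))) mulN1r.
have FC := sbounded_sum (index_enum I) Fb.
rewrite -(sphere_intD (sbounded_feval2 r r) FC); apply: sphere_int_ge0 => x xn.
have [x0|x0] := eqVneq (sqn x) 0.
  have z f : feval f (radial x) = 0.
    rewrite (@feval_homo _ _ _ f 0 x) ?expr0n ?gtn_eqF ?mul0r ?double_gt0// => i.
    by rewrite nth_radial x0 sqrtr0 invr0 mulr0 mul0r.
  by rewrite z mulr0 big1 ?addr0// => i _; rewrite /F z !mulr0.
have xn' : size (radial x) = n by rewrite size_radial.
have x1 := sqn_radial x0.
rewrite feval_r// mulr1 /F -mulr_sumr mulN1r subr_ge0.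
by under eq_bigr do rewrite -expr2; exact: h.
Qed.

Lemma orthogonal_comp f (U : 'M[R]_n) : U *m U^T = 1%:M ->
  exists g, [/\ forall x, size x = n -> feval g x = feval f (lst (vec n x *m U)),
    sint g = sint f & sip g g = sip f f].
Proof.
move=> UU; have [g hg] := isform_comp f U; exists g; split.
- by move=> x xn; rewrite hg.
- rewrite -[RHS](sphere_int_orthogonal UU (sbounded_feval f)).
  by apply: eq_sphere_int_size => x xn; rewrite hg.
- rewrite -[RHS](sphere_int_orthogonal UU (sbounded_feval2 f f)).
  by apply: eq_sphere_int_size => x xn; rewrite hg.
Qed.

Local Notation m := (#|{: mon n d}|).-1.
Variables (P : 'M[R]_m) (psi : 'I_m -> form).
Hypothesis Pu : P \in unitmx.
Hypothesis psi0 : forall i, sint (psi i) = 0.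
Hypothesis psiO : forall i j, sip (psi i) (psi j) = (i == j)%:R.
Hypothesis psiS : forall f, sint f = 0 -> exists u : 'rV[R]_m, f = \sum_i u 0 i *: psi i.
Hypothesis psiP : forall f (u : 'rV[R]_m),
  Defs.proj (f + \sum_i u 0 i *: psi i) = lst (vec m (Defs.proj f) + u *m P).
Implicit Types (u w : 'rV[R]_m).

Local Notation Psi u := (\sum_i u 0 i *: psi i).
Definition psiv v : 'rV[R]_m := \row_i feval (psi i) v.
Definition coord f : 'rV[R]_m := \row_i sip f (psi i).

Lemma coord_Psi u : coord (Psi u) = u.
Proof.
apply/rowP => j; rewrite mxE sip_suml (bigD1 j)//= sipZl psiO eqxx mulr1.
by rewrite big1 ?addr0// => i ij; rewrite sipZl psiO (negbTE ij) mulr0.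
Qed.

Lemma Psi_coord f : sint f = 0 -> f = Psi (coord f).
Proof. by move=> /psiS[u ->]; rewrite coord_Psi. Qed.

Lemma Psi_inj u w : Psi u = Psi w -> u = w.
Proof. by move=> E; rewrite -(coord_Psi u) E coord_Psi. Qed.

Lemma PsiD u w : Psi (u + w) = Psi u + Psi w.
Proof. by rewrite -big_split; apply: eq_bigr => i _; rewrite mxE scalerDl. Qed.

Lemma PsiZ a u : Psi (a *: u) = a *: Psi u.
Proof. by rewrite scaler_sumr; apply: eq_bigr => i _; rewrite mxE scalerA. Qed.

Lemma sint_Psi u : sint (Psi u) = 0.
Proof. by rewrite sint_sum big1// => i _; rewrite sintZ psi0 mulr0. Qed.

Lemma sip_Psi u w : sip (Psi u) (Psi w) = (u *m w^T) 0 0.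
Proof.
rewrite sip_sumr mxE; apply: eq_bigr => j _; rewrite sipZr mulrC mxE; congr (_ * _).
by rewrite -[in RHS](coord_Psi u) mxE.
Qed.

Lemma feval_Psi u v : feval (Psi u) v = (u *m (psiv v)^T) 0 0.
Proof.
by rewrite feval_sum mxE; apply: eq_bigr => i _; rewrite fevalZ !mxE.
Qed.

Lemma dotC u w : (u *m w^T) 0 0 = (w *m u^T) 0 0.
Proof. by rewrite !mxE; apply: eq_bigr => i _; rewrite !mxE mulrC. Qed.

Lemma dot_le u w : 2 * (u *m w^T) 0 0 <= (u *m u^T) 0 0 + (w *m w^T) 0 0.
Proof.
have := sqr_mulmx_ge0 (u - w); rewrite linearB /= mulmxBl !mulmxBr !mxE.
move=> h; have := dotC u w; rewrite !mxE => E; lra.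
Qed.

(* Reflections carry [psi] to another orthonormal system, so that the sum of
   squares of the [psi i], being basis independent, is constant on the sphere. *)
Lemma psiv_le v x : size v = n -> size x = n -> sqn v = 1 -> sqn x = 1 ->
  (psiv x *m (psiv x)^T) 0 0 <= (psiv v *m (psiv v)^T) 0 0.
Proof.
move=> vn xn v1 x1; have [U [UU vU]] := orthogonal_transitive vn xn v1 x1.
(* At [v] the form [g] takes the value |psi(x)|^2, and its coordinate vector [u] has the same square
   norm |psi(x)|^2. [dot_le] for [u] and [psiv v] then gives the claim. *)
have [g [gE g0 gg]] := orthogonal_comp (Psi (psiv x)) UU.
rewrite sint_Psi in g0; have [u gu] := psiS g0.
rewrite gu !sip_Psi in gg.
have := gE _ vn; rewrite vU gu !feval_Psi => E.
by have := dot_le u (psiv v); rewrite gg E; lra.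
Qed.

Lemma psiv_sqr v : size v = n -> sqn v = 1 -> (psiv v *m (psiv v)^T) 0 0 = m%:R.
Proof.
move=> vn v1; set z := (_ *m _) 0 0.
have z0 : 0 <= z by exact: sqr_mulmx_ge0.
have Fb (i : 'I_m) := sbounded_feval2 (psi i) (psi i).
have -> : m%:R = sphere_int n (fun x => \sum_i feval (psi i) x * feval (psi i) x).
  rewrite (sphere_int_sum (index_enum 'I_m) Fb).
  rewrite (eq_bigr (fun=> 1)) => [|i _]; last first.
    by have := psiO i i; rewrite eqxx.
  by rewrite sumr_const card_ord.
rewrite -[LHS](@sphere_int_cst R n); symmetry.
have FC := sbounded_sum (index_enum 'I_m) Fb.
apply: (eq_sphere_int n_gt0 FC (sbounded_cst n z0)) => x xn x1.
transitivity ((psiv x *m (psiv x)^T) 0 0).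
  by rewrite mxE; apply: eq_bigr => i _; rewrite !mxE.
by apply/eqP; rewrite eq_le !psiv_le.
Qed.

Lemma M_Psi f : Mset f -> exists u, f = r + Psi u.
Proof.
move=> fM; have [|u E] := psiS (f := f - r); first by rewrite sintB sint_r (fM : sint f = 1) subrr.
by exists u; rewrite -E addrC subrK.
Qed.

Lemma Mset_Psi u : Mset (r + Psi u).
Proof. by rewrite /Mset /= -/(sint _) sintD sint_r sint_Psi addr0. Qed.

Lemma reproducing v g : size v = n -> sqn v = 1 ->
  sip (r + Psi (psiv v)) g = feval g v.
Proof.
move=> vn v1; pose s := sint g.
have [|u gu] := psiS (f := g - s *: r).
  by rewrite sintB sintZ sint_r mulr1 subrr.
have -> : g = s *: r + Psi u by rewrite -gu addrC subrK.
rewrite sipDl !sipDr !sipZr !sip_r sint_r sint_Psi sipC sip_r sint_Psi sip_Psi.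
by rewrite fevalD fevalZ feval_r// feval_Psi dotC; ring.
Qed.

Lemma Cbar_kernel v : size v = n -> sqn v = 1 -> Cbar (r + Psi (psiv v)).
Proof.
move=> vn v1; split; last exact: Mset_Psi.
by move=> g gC; rewrite reproducing//; exact: gC.
Qed.

Lemma Cbar_norm u : Cbar (r + Psi u) -> (u *m u^T) 0 0 <= m%:R.
Proof.
move=> [fC _]; set t := (_ *m _) 0 0.
pose a := 1 + (t + m%:R) / 2.
have /fC : Cnn (a *: r - (r + Psi u)).
  move=> x xn.
  have [x0|x0] := eqVneq (sqn x) 0; first by rewrite feval_sqn0 ?double_gt0.
  rewrite feval_radial// mulr_ge0// ?exprn_ge0 ?sqrtr_ge0//.
  have xn' : size (radial x) = n by rewrite size_radial.
  have x1 := sqn_radial x0.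
  rewrite fevalD fevalZ -scaleN1r fevalZ fevalD feval_r// feval_Psi.
  have := dot_le u (psiv (radial x)); rewrite psiv_sqr// -/t /a; lra.
have f1 : sip (r + Psi u) r = 1.
  by rewrite sipC sip_r sintD sint_r sint_Psi addr0.
have ff : sip (r + Psi u) (r + Psi u) = 1 + t.
  by rewrite sipDr f1 sipDl sip_r sint_Psi add0r sip_Psi.
rewrite sipDr sipZr -scaleN1r sipZr f1 ff /a; lra.
Qed.

(** * Ellipsoids in orthonormal coordinates *)

Definition ellipse (c : form) (A : 'M[R]_m) : set form :=
  [set c + Psi (u *m A) | u in [set u : 'rV[R]_m | (u *m u^T) 0 0 <= 1]].

Lemma snorm_Psi u (a : R) : 0 <= a ->
  (snorm (Psi u) <= Num.sqrt a) = ((u *m u^T) 0 0 <= a).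
Proof. by move=> a0; rewrite /snorm sip_Psi ler_sqrt. Qed.

(** The matrix of the restriction of [L] to the mean-zero forms, acting on row vectors from the
    right. *)
Definition mat (L : form -> form) : 'M[R]_m :=
  \matrix_(i, j) sip (L (psi i)) (psi j).

Lemma Psi_mulmx u (A : 'M[R]_m) : Psi (u *m A) = \sum_i u 0 i *: Psi (row i A).
Proof.
under [RHS]eq_bigr do rewrite scaler_sumr.
rewrite exchange_big; apply: eq_bigr => j _; rewrite mxE scaler_suml.
by apply: eq_bigr => i _; rewrite scalerA mxE.
Qed.

Lemma linear_Psi (L : {linear form -> form}) u :
  (forall f, Hset f -> Hset (L f)) -> L (Psi u) = Psi (u *m mat L).
Proof.
move=> LH; rewrite linear_sum Psi_mulmx; apply: eq_bigr => i _.
rewrite linearZ /=; congr (_ *: _); rewrite [LHS]Psi_coord; last exact/LH/psi0.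
by apply: eq_bigr => j _; rewrite !mxE.
Qed.

Lemma ellipsoid_ellipse (E : set form) : ellipsoid E ->
  exists u (A : 'M[R]_m), A \in unitmx /\ E = ellipse (r + Psi u) A.
Proof.
move=> [c [cM [L [LH [Linj ->]]]]]; have [u ->] := M_Psi cM.
exists u, (mat L); split.
  rewrite -row_free_unit; apply: inj_row_free => w wL.
  have : L (Psi w) = 0.
    by rewrite linear_Psi// wL big1// => i _; rewrite mxE scale0r.
  move=> /(Linj _ (sint_Psi w)) w0; rewrite -(coord_Psi w) w0.
  by apply/rowP => i; rewrite !mxE sip0l.
apply/seteqP; split=> _ [w /= w1 <-].
  case: w1 => /Psi_coord wE w1; exists (coord w) => /=.
    by rewrite -snorm_Psi// sqrtr1 -wE.
  by rewrite -linear_Psi// -wE.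
exists (Psi w); last by rewrite linear_Psi.
by split; [exact: sint_Psi|rewrite -sqrtr1 snorm_Psi].
Qed.

(** All ellipsoids share the factor after |det A|, so comparing volumes amounts to comparing
    determinants. *)
Lemma volM_ellipse c (A : 'M[R]_m) : A \in unitmx ->
  volM (ellipse c A) = (`|\det A| * (`|\det P| * ball_vol R m))%:E.
Proof.
move=> Au; rewrite /volM mulrA -normrM -det_mulmx.
rewrite -(lebm_affine_ball (vec m (Defs.proj c))); last by rewrite unitmx_mul Au.
congr lebm; rewrite /ellipse image_comp; apply: eq_imagel => u _ /=.
by rewrite psiP mulmxA.
Qed.

Local Notation rho := (Num.sqrt m%:R : R).

Lemma ball_ellipse : (0 < m)%N -> [set f | Mset f /\ snorm (f - r) <= rho] = ellipse r rho%:M.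
Proof.
move=> m_gt0; have rho2 : rho ^+ 2 = m%:R by rewrite sqr_sqrtr.
have m0 : (0 : R) < m%:R by rewrite ltr0n.
have rho0 : 0 < rho by rewrite sqrtr_gt0.
apply/seteqP; split=> [f [/= fM fr]|_ [u /= u1 <-]].
  have [u fE] := M_Psi fM; exists (rho^-1 *: u) => /=.
    move: fr; rewrite fE addrAC subrr add0r snorm_Psi ?(ltW m0)// => um.
    rewrite linearZ /= -scalemxAl -scalemxAr scalerA mxE -invfM -expr2 rho2.
    by rewrite mulrC ler_pdivrMr// mul1r.
  by rewrite mul_mx_scalar scalerA mulfV ?gt_eqF// scale1r -fE.
split; first exact: Mset_Psi.
rewrite addrAC subrr add0r snorm_Psi ?(ltW m0)// mul_mx_scalar linearZ /=.
rewrite -scalemxAl -scalemxAr scalerA mxE -expr2 rho2.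
by rewrite ler_piMr// ltW.
Qed.

Lemma kernel_frobenius u (A : 'M[R]_m) : A \in unitmx ->
  @Cbar R n d `<=` ellipse (r + Psi u) A ->
  \sum_i \sum_j invmx A i j ^+ 2 +
    ((u *m invmx A) *m (u *m invmx A)^T) 0 0 <= 1.
Proof.
move=> Au KE; set B := invmx A; pose kap := u *m B.
(* On the sphere [phi j] is the j-th coordinate of (psi(v) - u) B; multiplying the constant term by
   [r] makes it a form of the right degree. *)
pose phi j := Psi (row j B^T) - kap 0 j *: r.
(* [r] has norm one and is orthogonal to the mean-zero forms, so the two parts of [phi j] contribute
   separately. *)
have phiE j : sip (phi j) (phi j) = \sum_i B i j ^+ 2 + kap 0 j ^+ 2.
  have E h : sip (phi j) h = sip (Psi (row j B^T)) h - kap 0 j * sip r h.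
    by rewrite /phi sipBl sipZl.
  rewrite E [sip (Psi _) _]sipC [sip r _]sipC !E sip_Psi.
  rewrite [sip (Psi _) r]sipC !sip_r sint_r sint_Psi mulr0 subr0 sub0r mulr1 mulrN opprK expr2.
  by congr (_ + _); rewrite mxE; apply: eq_bigr => i _; rewrite !mxE expr2.
have phi_v v j : size v = n -> sqn v = 1 ->
    feval (phi j) v = ((psiv v - u) *m B) 0 j.
  move=> vn v1; rewrite /phi fevalD -scaleN1r !fevalZ feval_r// feval_Psi.
  rewrite mulmxBl [in RHS]mxE [X in _ = _ + X]mxE mulN1r mulr1; congr (_ - _).
  by rewrite !mxE; apply: eq_bigr => i _; rewrite !mxE mulrC.
have := @sum_sip_le1 _ phi; under eq_bigr do rewrite phiE.
rewrite big_split /= exchange_big /= => H.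
apply: le_trans (H _) => [|v vn v1].
  by rewrite lerD2l mxE; apply: ler_sum => j _; rewrite [X in _ * X]mxE expr2.
(* That q_v lies in the ellipsoid means psi(v) - u = w A with |w| <= 1, and [B] recovers [w]. *)
have [w /= w1 E] := KE _ (Cbar_kernel vn v1).
have {}E : psiv v - u = w *m A.
  apply: Psi_inj; apply: (addrI (r + Psi u)); rewrite E -addrA -PsiD.
  by rewrite [u + _]addrC subrK.
apply: le_trans w1; rewrite mxE; apply: ler_sum => j _.
by rewrite phi_v// E mulmxK// mxE expr2.
Qed.

Lemma volume_minimal u (A : 'M[R]_m) : (0 < m)%N -> A \in unitmx ->
  @Cbar R n d `<=` ellipse (r + Psi u) A ->
  rho ^+ m <= `|\det A| /\
  (`|\det A| = rho ^+ m -> ellipse (r + Psi u) A = ellipse r rho%:M).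
Proof.
move=> m0 Au /(kernel_frobenius Au); set B := invmx A; set q := (_ *m _^T) 0 0 => Bq.
have q0 : 0 <= q by exact: sqr_mulmx_ge0.
have Bu : B \in unitmx by rewrite unitmx_inv.
have B1 : \sum_i \sum_j B i j ^+ 2 <= 1 by lra.
have [detB eqB] := det_frobenius m0 Bu B1.
have rho0 : 0 < rho by rewrite sqrtr_gt0 ltr0n.
have rho2 : rho ^+ 2 = m%:R by rewrite sqr_sqrtr.
have AB : `|\det A| * `|\det B| = 1.
  by rewrite -normrM -det_mulmx mulmxV// det1 normr1.
have A0 : 0 < `|\det A| by rewrite normr_gt0 -unitfE -unitmxE.
(* This turns the bound m^(-m) on det(B)^2 into the bound rho^m on |det A|. *)
have rhoX : (rho ^+ m) ^+ 2 * m%:R^-1 ^+ m = 1.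
  by rewrite exprAC rho2 -exprMn mulfV ?expr1n// pnatr_eq0 -lt0n.
split.
  have : rho ^+ m * `|\det B| <= 1.
    rewrite -(@ler_pXn2r _ 2)// ?nnegrE ?mulr_ge0 ?exprn_ge0 ?(ltW rho0)//.
    rewrite exprMn expr1n real_normK ?num_real// -[leRHS]rhoX ler_wpM2l//.
  by rewrite -(ler_pM2r A0) mul1r -mulrA [X in _ * X <= _]mulrC AB mulr1.
move=> detA.
have /eqB[B1' BB] : \det B ^+ 2 = m%:R^-1 ^+ m.
  have rN0 : (rho ^+ m) ^+ 2 != 0 by rewrite !expf_neq0// gt_eqF.
  apply: (mulfI rN0); rewrite rhoX -detA -[\det B ^+ 2]real_normK ?num_real//.
  by rewrite -exprMn AB expr1n.
(* In the equality case |B|_F^2 alone reaches 1, so nothing remains for the displacement of the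
   centre. *)
have u0 : u = 0.
  have : q = 0 by lra.
  move=> /eqP; rewrite sqr_mulmx_eq0 => /eqP/(congr1 (mulmx^~ A)).
  by rewrite mulmxKV// mul0mx.
(* [B] divides lengths by [rho], so [A] maps the unit ball onto the ball of radius [rho]. *)
have BBx (x : 'rV[R]_m) : ((x *m B) *m (x *m B)^T) 0 0 = (x *m x^T) 0 0 / m%:R.
  rewrite trmx_mul mulmxA -(mulmxA x) BB mul_mx_scalar -scalemxAl mxE.
  by rewrite mulrC.
have -> : r + Psi u = r.
  by rewrite big1 ?addr0// => i _; rewrite u0 mxE scale0r.
have mR0 : (0 : R) < m%:R by rewrite ltr0n.
apply/seteqP; split=> _ [w /= w1 <-].
  exists (rho^-1 *: (w *m A)) => /=.
    rewrite linearZ /= -scalemxAl -scalemxAr scalerA mxE -invfM -expr2 rho2.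
    have := BBx (w *m A); rewrite mulmxK// => E.
    by rewrite mulrC -E.
  by rewrite mul_mx_scalar scalerA mulfV ?gt_eqF// scale1r.
exists (rho *: (w *m B)) => /=.
  rewrite linearZ /= -scalemxAl -scalemxAr scalerA mxE -expr2 rho2 BBx.
  by rewrite mulrC divfK// gt_eqF.
by rewrite -scalemxAl mulmxKV// mul_mx_scalar.
Qed.

Lemma ellipsoid_ball : (0 < m)%N -> ellipsoid (ellipse r rho%:M).
Proof.
move=> m_gt0; have rho0 : rho != 0 by rewrite gt_eqF// sqrtr_gt0 ltr0n.
exists r; split; first exact: sint_r.
exists ( *:%R rho : {linear form -> form}); split; last split.
- by move=> f fH; rewrite /Hset /= -/(sint _) sintZ (fH : sint f = 0) mulr0.
- by move=> f _ /(congr1 ( *:%R rho^-1)); rewrite /= scaler0 scalerA mulVf// scale1r.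
apply/seteqP; split=> _ [w /= w1 <-].
  exists (Psi w); last by rewrite /= mul_mx_scalar PsiZ.
  by split; [exact: sint_Psi|rewrite -sqrtr1 snorm_Psi].
case: w1 => /Psi_coord wE w1; exists (coord w) => /=.
  by rewrite -snorm_Psi// sqrtr1 -wE.
by rewrite mul_mx_scalar PsiZ -wE.
Qed.

Lemma loewner_ball : (0 < m)%N ->
  loewner_ellipsoid (@Cbar R n d) [set f | Mset f /\ snorm (f - r) <= rho].
Proof.
move=> m_gt0; have rho0 : 0 < rho by rewrite sqrtr_gt0 ltr0n.
have rhoX0 : 0 <= rho ^+ m by rewrite exprn_ge0// ltW.
have rhou : (rho%:M : 'M[R]_m) \in unitmx.
  by rewrite unitmxE det_scalar unitfE expf_neq0// gt_eqF.
have vol0 : 0 < `|\det P| * ball_vol R m.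
  by rewrite mulr_gt0 ?ball_vol_gt0// normr_gt0 -unitfE -unitmxE.
split.
- by rewrite ball_ellipse//; exact: ellipsoid_ball.
- move=> f fC; have [_ fM] := fC; split=> //; have [u fE] := M_Psi fM.
  rewrite fE in fC *; rewrite addrAC subrr add0r snorm_Psi// .
  exact: Cbar_norm.
- move=> _ /ellipsoid_ellipse[u [A [Au ->]]] /(volume_minimal m_gt0 Au)[min eqE].
  rewrite ball_ellipse// !volM_ellipse// det_scalar ger0_norm// lee_fin.
  split; first by rewrite ler_wpM2r// ltW.
  by move=> [/(mulIf (lt0r_neq0 vol0))] /eqE.
Qed.

End Loewner.

Lemma card_mon_bin n d : (0 < n)%N -> #|{: mon n d}| = 'C(n + d - 1, d).
Proof.
by case: n => // n _; rewrite card_mon addSn subn1 -[in LHS]bin_sub ?leq_addr// addKn.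
Qed.

(** Ensures that the dimension [m] of the mean-zero forms is positive; one variable would not be
    enough for this. *)
Lemma card_mon_gt1 n d : (1 < n)%N -> (0 < d)%N -> (1 < #|{: mon n d}|)%N.
Proof.
case: n d => [|[|n]]// [|d]// _ _; rewrite card_mon.
rewrite addSn binS; apply: (@leq_add 1 1); rewrite bin_gt0 ?leq_addr//.
by rewrite addnS ltnS leq_addr.
Qed.

Theorem theorem5p2 (R : realType) (n k : nat) :
  (2 <= n)%N -> (1 <= k)%N ->
  forall r2k : pform R n k.*2,
    (forall x : seq R, size x = n -> feval r2k x = sqn x ^+ k) ->
  loewner_ellipsoid (@Cbar R n k.*2)
    [set f | @Mset R n k.*2 f /\
             snorm (f - r2k) <= Num.sqrt ('C(n + k.*2 - 1, k.*2)%:R - 1)].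
Proof.
move=> n2 k0 r2k rE; have n0 : (0 < n)%N by exact: ltnW.
have [P [psi [Pu psi0 psiO psiS psiP]]] := orthonormal_basis R n0 k0.
have card1 : (1 < #|{: mon n k.*2}|)%N by rewrite card_mon_gt1 ?double_gt0.
(* The binomial coefficient counts the monomials, so the radicand becomes the dimension [m]. *)
rewrite -card_mon_bin// -[#|_|]prednK ?(ltnW card1)// -natr1 addrK.
apply: (loewner_ball n0 k0 rE Pu psi0 psiO psiS psiP).
by rewrite -subn1 subn_gt0.
Qed.
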